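(* Let $a,b$ be coprime positive integers with $b\ge 2$, let $\chi$ be the character of the permutation action of $\mathfrak{S}_a\times\mathbb{Z}_{b-1}$ on $\mathsf{Park}^{NC}(a,b)$, and let $g$ be the generator of $\mathbb{Z}_{b-1}$. Then for all $w\in\mathfrak{S}_a$ and all $d\ge 0$, \[\chi(w,g^d)=b^{\mathrm{mult}_w(\zeta^d)}.\]
   Context: An $a,b$-Dyck path is a lattice path from $(0,0)$ to $(b,a)$ with unit north steps $N$ and east steps $E$ staying above the line $y=\frac{a}{b}x$; write it as $D=N^{v_0}EN^{v_1}E\cdots N^{v_{b-1}}E$, $v_i\ge 0$. A vertical run of length $v$ is a $P$-rise if $v>a/b$ and a $Q$-rise if $v<a/b$. For $1\le i\le b-1$ the label $i$ is the point $(i,v_0+\dots+v_{i-1})$. If $v_i>0$, the laser $\ell(i)$ is the segment of slope $a/b$ from label $i$ going northeast until it next meets $D$ (in the interior of an east step). $\ell(D)$ is the set of pairs $(i,j)$ with $\ell(i)$ ending on the east step whose west endpoint has $x$-coordinate $j$. The labeled pair $\pi(D)=(P,Q)$ of set partitions of $[b-1]$: $i,j$ in the same block of $P$ iff labels $i,j$ are not separated by any laser (label $k$ lies strictly below $\ell(k)$), and a block $B\in P$ gets rank $v_{\min(B)-1}$; $Q$ is the equivalence relation generated by $i\sim j$ whenever $\ell(i),\ell(j)$ end on the same east step immediately following a $Q$-rise, or $(i,j)\in\ell(D)$, or $(j,i)\in\ell(D)$, and a block $B\in Q$ gets rank $v_{\max(B)}$. $NC(a,b)=\{\pi(D)\}$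 over all $a,b$-Dyck paths; $\mathrm{rot}$ (applying $i\mapsto i+1$, $b-1\mapsto1$, to all blocks, ranks kept) preserves $NC(a,b)$. $\mathsf{Park}^{NC}(a,b)$ is the set of pairs $((P,Q),f)$ with $(P,Q)\in NC(a,b)$ and $f$ assigning to each block $B$ of $P$ or of $Q$ a subset $f(B)\subseteq[a]$ with $|f(B)|=\mathrm{rank}(B)$, such that $[a]$ is the disjoint union of all the $f(B)$. $w\in\mathfrak{S}_a$ acts by $f(B)\mapsto w(f(B))$; the generator $g$ of $\mathbb{Z}_{b-1}$ acts by replacing $(P,Q)$ with $\mathrm{rot}(P,Q)$ and giving $\mathrm{rot}(B)$ the set $f(B)$. Let $V=\mathbb{C}^a/\langle(1,\dots,1)\rangle$ with $\mathfrak{S}_a$ permuting coordinates, $\zeta=e^{2\pi i/(b-1)}$, and $\mathrm{mult}_w(\zeta^d)$ the multiplicity of $\zeta^d$ as an eigenvalue of $w$ acting on $V$. *)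

(* Defs.v *)
From HB Require Import structures.
From mathcomp Require Import all_boot all_order all_algebra all_fingroup.
From mathcomp Require Import mxrepresentation complex.
From mathcomp Require Import reals trigo.

Set Implicit Arguments.
Unset Strict Implicit.
Unset Printing Implicit Defensive.

Import Order.TTheory GRing.Theory Num.Theory.

(* The set [b-1], for b >= 2: the label i is the ordinal of value i - 1.      *)
(* The bound is written b.-2.+1 rather than b.-1 because 'I_n.+1 is           *)
(* canonically the additive group Z/(n+1), so that 'I_(b.-2.+1) is also the   *)
(* group Z_{b-1}, trivial for b = 2.                                          *)
Notation label b := 'I_(b.-2.+1).
Definition lab (b : nat) (i : label b) : nat := i.+1.

(* A block of P is tagged by inl, a block of Q by inr: the same subset of     *)
(* [b-1] may be a block of both.                                              *)
Definition tblock (b : nat) : finType := ({set label b} + {set label b})%type.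

(* Families indexed by the blocks of a pair (P, Q): None off the blocks.      *)
Definition family_on (b : nat) (T : finType) : finType :=
  {ffun tblock b -> option T}.

(* The pair (P, Q) is the domain of its rank function. *)
Definition ranked_pair (a b : nat) : finType := family_on b 'I_a.+1.

Section Paths.
Variables a b : nat.

(* N^{v_0} E ... N^{v_{b-1}} E *)
Implicit Type D : b.-tuple 'I_a.+1.

Definition run D (i : nat) : 'I_a.+1 := nth ord0 D i.

Definition height D (i : nat) : nat := \sum_(0 <= k < i) run D k.

(* The vertices (i, height D i) are those closest to the line y = (a/b) x. *)
Definition is_dyck D : bool :=
  (height D b == a) && [forall i : 'I_b.+1, a * i <= b * height D i].

Definition Qrise D (j : nat) : bool := b * run D j < a.

(* The line of slope a/b through label i meets the interior of the east step  *)
(* from (j, height D j.+1) to (j.+1, height D j.+1).                          *)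
Definition crosses D (i j : nat) : bool :=
  (i <= j) &&
  (b * height D i + a * (j - i) < b * height D j.+1
                                < b * height D i + a * (j.+1 - i)).

Definition lasers D : {set label b * label b} :=
  [set ij | [&& 0 < run D (lab ij.1), crosses D (lab ij.1) (lab ij.2)
     & [forall k : label b, (k < ij.2) ==> ~~ crosses D (lab ij.1) (lab k)]]].

(* Label i lies above the laser l = (k, j); this is strict, so that label k   *)
(* lies below its own laser.                                                  *)
Definition above D (l : label b * label b) (i : label b) : bool :=
  (lab l.1 < lab i <= lab l.2) &&
  (b * height D (lab l.1) + a * (lab i - lab l.1) < b * height D (lab i)).

Definition Prel D : rel (label b) :=
  fun i j => [forall l in lasers D, above D l i == above D l j].

Definition Qgen D : rel (label b) :=
  fun i j =>
    [|| [exists k : label b,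
           [&& Qrise D (lab k), (i, k) \in lasers D & (j, k) \in lasers D]],
        (i, j) \in lasers D | (j, i) \in lasers D].

Definition Pblocks D : {set {set label b}} :=
  equivalence_partition (Prel D) [set: label b].

(* Qgen is symmetric, so its reflexive transitive closure is the equivalence  *)
(* relation that it generates.                                                *)
Definition Qblocks D : {set {set label b}} :=
  equivalence_partition (connect (Qgen D)) [set: label b].

Definition min_label (B : {set label b}) : nat := \big[minn/b]_(i in B) lab i.
Definition max_label (B : {set label b}) : nat := \max_(i in B) lab i.

Definition pair_of_path D : ranked_pair a b :=
  [ffun B => match B with
    | inl B => if B \in Pblocks D then Some (run D (min_label B).-1) else None
    | inr B => if B \in Qblocks D then Some (run D (max_label B)) else None
    end].

Definition NC : {set ranked_pair a b} :=
  [set pair_of_path D | D in [set D | is_dyck D]].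

(* For the disjoint union, blocks of rank 0 carry the empty set. *)
Definition ParkNC : {set ranked_pair a b * family_on b {set 'I_a}} :=
  [set x : ranked_pair a b * family_on b {set 'I_a} | let: (PQ, f) := x in
     let S B := odflt set0 (f B) in
     [&& PQ \in NC,
         [forall B, omap (fun X : {set 'I_a} => #|X|) (f B)
                      == omap val (PQ B)],
         [forall B, forall C, (B != C) ==> [disjoint S B & S C]]
       & \bigcup_B S B == setT]].

End Paths.

Section Action.
Variables a b : nat.
Implicit Types (k l : label b) (w : 'S_a).

(* rot^k on subsets of [b-1]: i |-> i + k modulo b - 1. *)
Definition rot_set k (B : {set label b}) : {set label b} :=
  [set (i + k)%R | i in B].

Definition rot_block k (B : tblock b) : tblock b :=
  match B with inl B => inl (rot_set k B) | inr B => inr (rot_set k B) end.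

(* The family taking at rot^k B the value of F at B. *)
Definition rot_family (T : finType) k (F : family_on b T) : family_on b T :=
  [ffun B => F (rot_block (- k)%R B)].

Definition perm_family w (f : family_on b {set 'I_a}) :
    family_on b {set 'I_a} :=
  [ffun B => omap (fun X : {set 'I_a} => w @: X) (f B)].

Definition park_act (x : ranked_pair a b * family_on b {set 'I_a})
    (wk : 'S_a * label b) : ranked_pair a b * family_on b {set 'I_a} :=
  (rot_family wk.2 x.1, perm_family wk.1 (rot_family wk.2 x.2)).

Lemma rot_block0 B : rot_block (- 0)%R B = B.
Proof.
have rot0 C : rot_set 0%R C = C.
  by rewrite -[RHS]imset_id; apply: eq_imset => i; rewrite addr0.
by rewrite oppr0; case: B => B; rewrite /= rot0.
Qed.

Lemma rot_blockD k l B :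
  rot_block (- (k + l))%R B = rot_block (- k)%R (rot_block (- l)%R B).
Proof.
have rotD C : rot_set (- l - k)%R C = rot_set (- k)%R (rot_set (- l)%R C).
  by rewrite /rot_set -imset_comp; apply: eq_imset => i; rewrite /= addrA.
by rewrite opprD addrC; case: B => B; rewrite /= rotD.
Qed.

Fact park_act1 : park_act^~ 1%g =1 id.
Proof.
case=> PQ f; congr (_, _); apply/ffunP => B; rewrite !ffunE rot_block0 //.
case: (f B) => //= X; congr Some; rewrite -[RHS]imset_id.
by apply: eq_imset => i; rewrite perm1.
Qed.

Fact park_actM x : act_morph park_act x.
Proof.
case: x => PQ f [w k] [v l].
congr (_, _); apply/ffunP => B; rewrite !ffunE rot_blockD //.
case: (f _) => //= X; congr Some; rewrite -imset_comp.
by apply: eq_imset => i; rewrite /= permM.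
Qed.

(* ParkNC a b is stable under this action because NC a b is stable under rot. *)
Definition park_action := TotalAction park_act1 park_actM.

(* i |-> i + 1, b - 1 |-> 1 *)
Definition rot_gen : label b := Zp1.

End Action.

(* Trace of x on the vector space F^S with its basis permuted by x. *)
Definition perm_char (F : fieldType) (gT : finGroupType) (T : finType)
    (to : {action gT &-> T}) (S : {set T}) (x : gT) : F :=
  \tr (\matrix_(i < #|S|, j < #|S|) (to (enum_val i) x == enum_val j)%:R)%R.

Section Reflection.
Variables (F : fieldType) (a : nat).

Fact perm_mx_is_repr : mx_repr [set: 'S_a] (@perm_mx F a).
Proof. by split=> [|w v _ _]; rewrite ?perm_mx1 ?perm_mxM. Qed.
Definition perm_mx_repr := MxRepresentation perm_mx_is_repr.

(* The row space of const_mx 1 is the line spanned by (1, ..., 1). *)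
Fact ones_mxmodule : mxmodule perm_mx_repr (const_mx 1%R : 'M_a).
Proof.
apply/mxmoduleP=> w _.
suff -> : (const_mx 1 *m perm_mx_repr w = const_mx 1 :> 'M[F]_a)%R by [].
rewrite /= -[w]invgK -col_permE.
by apply/matrixP=> i j; rewrite !mxE.
Qed.

(* F^a / <(1, ..., 1)> *)
Definition refl_repr := factmod_repr ones_mxmodule.

Definition eig_mult (w : 'S_a) (z : F) : nat := mup z (char_poly (refl_repr w)).

End Reflection.

Definition zeta (R : realType) (n : nat) : R[i] :=
  let t : R := (2 * pi / n%:R)%R in (cos t +i* sin t)%C.

(* Main.v *)
(* Put h(i) = b * height(i) - a * i.  By coprimality h takes distinct values
   on 0, ..., b-1, and it vanishes exactly at 0 and b.  The laser of label k
   ends on the east step just before the next index where h is below h(k), so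
   two labels lie in the same block of P (resp. Q) exactly when they have the
   same previous (resp. next) lower index.  Hence the b runs of the path are in
   bijection with the blocks of P and Q: ascents of h with blocks of P,
   descents with blocks of Q.  A decorated pair is thus a parking function
   psi : [a] -> {0, ..., b-1}.

   Let s = d mod (b-1).  If s = 0, the fixed points are the parking functions
   constant on the cycles of w, and the cycle lemma gives one of them in each
   orbit of Z_b on the b^(number of cycles) functions constant on cycles.
   If s <> 0, an s-invariant pair has exactly one s-invariant block, its
   center: two invariant blocks would cross, and without any, all orbits of
   blocks would have the size of the order of s, which divides b - 1 and so
   not b.  Removing the central run, the other b - 1 runs are permuted
   cyclically by rotation, which identifies the fixed points with all the
   functions phi from [a] to Z_(b-1) plus a fixed center satisfying
   phi (w y) = phi y + s.  There are b values to choose for each cycle of w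
   whose length kills s, and phi is at the center on the other cycles.

   The multiplicity of z = zeta^d is read off the traces of the powers of w:
   it is the number of cycles of length l with z^l = 1, minus 1 if z = 1. *)
Require Import Defs.
From mathcomp Require Import all_boot all_order all_algebra all_fingroup.
From mathcomp Require Import complex reals.
From mathcomp Require Import mxrepresentation cyclotomic separable trigo.
From mathcomp Require Import zify lra.

Set Implicit Arguments.
Unset Strict Implicit.
Unset Printing Implicit Defensive.

Import Order.TTheory GRing.Theory Num.Theory.

(** * Excursions and their vertex blocks *)

Section Heights.
Variable m : nat.
Local Notation b := m.+2.
Implicit Types (h : nat -> int) (i j k : nat).

(** The properties of the level of a Dyck path that matter, with steps of any size allowed.
    Injectivity on 0, ..., b-1, supplied by coprimality, makes every comparison of levels strict. *)
Record excursion h : Prop := Excursion {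
  exc0 : h 0 = 0%R;
  excb : h b = 0%R;
  exc_gt0 : forall i, 0 < i < b -> (0 < h i)%R;
  exc_inj : forall i j, i < b -> j < b -> h i = h j -> i = j
}.

(** The value 0 of the empty maximum is harmless: [h 0 < h k] for 0 < k < b. *)
Definition prev_low h k : nat := \max_(i < k | (h i < h k)%R) i.
(** The scan covers k+1, ..., b-1. When it fails, [find] returns the length of the list and the
    value is b, as it should be since [h b = 0]. *)
Definition next_low h k : nat :=
  k.+1 + find (fun j => (h j < h k)%R) (iota k.+1 (b - k.+1)).

(* If h is the level of a path, this is the block of P or Q ranked by run i. *)
Definition vertex_block h i : tblock b :=
  if (h i < h i.+1)%R
  then inl [set k : label b | prev_low h (lab k) == i]
  else inr [set k : label b | next_low h (lab k) == i.+1].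

(** Recovers the run that ranks a block from the block alone: v_{min B - 1} on the P side, v_{max B}
    on the Q side. *)
Definition block_index (B : tblock b) : nat :=
  match B with inl B => (min_label B).-1 | inr B => max_label B end.

Section Excursion.
Variables (h : nat -> int) (hE : excursion h).

Lemma exc_neq i j : i < b -> j < b -> i != j -> (h i != h j)%R.
Proof. by move=> ib jb; apply: contra => /eqP /(exc_inj hE ib jb) ->. Qed.

Lemma prev_lowP k : 0 < k < b ->
  [/\ prev_low h k < k, (h (prev_low h k) < h k)%R
    & forall j, prev_low h k < j < k -> (h k < h j)%R].
Proof.
move=> kb; have k0 : 0 < k by lia.
have h0 : (h (Ordinal k0) < h k)%R by rewrite /= (exc0 hE) exc_gt0.
rewrite /prev_low (bigop.bigmax_eq_arg (Ordinal k0)) //;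
  case: arg_maxnP => // i hi imax.
split=> // j /andP[ij jk]; rewrite lt_neqAle exc_neq //=; try lia.
rewrite leNgt; apply/negP => hjk.
by have := imax (Ordinal jk) hjk; rewrite /= leqNgt ij.
Qed.

Lemma prev_low_eq k i : 0 < k < b -> i < k -> (h i < h k)%R ->
  (forall j, i < j < k -> (h k <= h j)%R) -> prev_low h k = i.
Proof.
move=> kb ik hik hj; have [pk hp hlt] := prev_lowP kb.
case: (ltngtP (prev_low h k) i) => // c.
  by have := hlt i; rewrite c ik => /(_ isT); lia.
by have := hj (prev_low h k); rewrite c pk => /(_ isT); lia.
Qed.

Lemma next_lowP k : 0 < k < b ->
  [/\ k < next_low h k <= b, (h (next_low h k) < h k)%R
    & forall j, k < j < next_low h k -> (h k < h j)%R].
Proof.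
move=> kb; rewrite /next_low.
set p := fun j : nat => (h j < h k)%R; set s := iota _ _.
have hlt j : k < j < k.+1 + find p s -> (h k < h j)%R.
  move=> /andP[kj jf]; have ls : find p s <= b - k.+1.
    by rewrite (leq_trans (find_size _ _)) ?size_iota.
  have := @before_find _ 0 p s (j - k.+1); rewrite nth_iota; try lia.
  have -> : k.+1 + (j - k.+1) = j by lia.
  move=> /(_ ltac:(lia)) /negbT; rewrite /p -leNgt le_eqVlt => /orP[/eqP e|//].
  by have := exc_inj hE _ _ e; lia.
case: (boolP (has p s)) => [hs|hs].
  have := nth_find 0 hs; have := hs; rewrite has_find size_iota => fs.
  by rewrite nth_iota // => hp; split=> //; lia.
split=> //; move: hs hlt; rewrite has_find -leqNgt size_iota => fs _;
  have ls : find p s <= b - k.+1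
    by rewrite (leq_trans (find_size _ _)) ?size_iota.
  by lia.
have -> : k.+1 + find p s = b by lia.
by rewrite (excb hE) exc_gt0.
Qed.

Lemma next_low_eq k j : 0 < k < b -> k < j <= b -> (h j < h k)%R ->
  (forall i, k < i < j -> (h k <= h i)%R) -> next_low h k = j.
Proof.
move=> kb kj hjk hi; have [pk hp hlt] := next_lowP kb.
case: (ltngtP (next_low h k) j) => // c.
  by have := hi (next_low h k); rewrite c; case/andP: pk => -> _ /(_ isT); lia.
by have := hlt j; rewrite c; case/andP: kj => -> _ /(_ isT); lia.
Qed.

(** Makes the last index before the drop a representative of its Q-class: its level is at least
    [h k], hence above the level where the drop lands. *)
Lemma next_low_pred k : 0 < k < b ->
  next_low h (next_low h k).-1 = next_low h k.
Proof.
move=> kb; have [kn hn hlt] := next_lowP kb.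
case: (altP (k =P (next_low h k).-1)) => [<- //|ne].
have := hlt (next_low h k).-1;
  have -> : k < (next_low h k).-1 < next_low h k by lia.
move=> /(_ isT) hk; apply: next_low_eq; try lia.
Qed.

End Excursion.
End Heights.

(** * Rotating and recentering an excursion *)

Section Recenter.
Variable m : nat.
Local Notation b := m.+2.
Local Notation n := m.+1.
Variables (h h' : nat -> int).
Hypotheses (h0 : h 0 = 0%R) (hb : h b = 0%R) (h'0 : h' 0 = 0%R).

(* Rotating the labels by one replaces (v_0, ..., v_n) by
   (v_p, v_0, ..., v_(p-1), v_n, v_(p+1), ..., v_(n-1)), where p is the run of
   the P-block of the last label; tau gives the new position of each run. *)
Section Rotate.
Hypothesis hE : excursion m h.
Variable p : nat.
Hypothesis pE : p = prev_low h n.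
Let tau i := if i == p then 0 else if i == n then p.+1 else i.+1.
Hypothesis steps : forall i, i < b ->
  (h' (tau i).+1 - h' (tau i) = h i.+1 - h i)%R.

Let nb : 0 < n < b. Proof. lia. Qed.

Let rotate_low i : i <= p -> (h' i.+1 = h i + h p.+1 - h p)%R.
Proof.
have [pn hp hlt] := prev_lowP hE nb; rewrite -pE in pn hp hlt.
elim: i => [_|i IH ip].
  have := @steps p; rewrite /tau eqxx h0 h'0.
  by move=> /(_ ltac:(lia)); lia.
have := @steps i; rewrite /tau; have -> : (i == p) = false by lia. rewrite /=.
have -> : (i == n) = false by lia. rewrite /=.
by move=> /(_ ltac:(lia)); have := IH (ltnW ip); lia.
Qed.

(** The last run, of step [- h n], now stands just before the runs p+1, ..., n-1, so the levels
    after it lose [h n]. *)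
Let rotate_high i : p < i <= n -> (h' i.+1 = h i - h n)%R.
Proof.
have [pn hp hlt] := prev_lowP hE nb; rewrite -pE in pn hp hlt.
case/andP; elim: i => // i IH pi iN.
have := @steps i; rewrite /tau.
have -> : (i == n) = false by lia. rewrite /=.
case: ifP => [/eqP ip _|ip].
  have := @steps n; rewrite /tau; have -> : (n == p) = false by lia. rewrite /=.
  rewrite eqxx hb => /(_ ltac:(lia)).
  have := rotate_low (leqnn p); rewrite ip; lia.
by move=> /(_ ltac:(lia)); have := IH ltac:(lia) ltac:(lia); lia.
Qed.

(** This rests on the choice of p: h exceeds [h n] strictly between p and n, and
    [h p < h n <= h p.+1]. *)
Lemma rotate_gt0 i : 0 < i < b -> (0 < h' i)%R.
Proof.
have [pn hp hlt] := prev_lowP hE nb; rewrite -pE in pn hp hlt.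
case: i => // i ib; case: (leqP i p) => ip.
  rewrite rotate_low //.
  have hi : (0 <= h i)%R.
    by case: (posnP i) => [->|i0]; [rewrite h0|apply/ltW/(exc_gt0 hE); lia].
  case: (altP (n =P p.+1)) => [e|ne]; first by rewrite -e; lia.
  by have := hlt p.+1 ltac:(lia); lia.
by rewrite rotate_high; [have := hlt i ltac:(lia)|]; lia.
Qed.

Hypothesis hE' : excursion m h'.

Lemma rotate_prev k : 0 < k < b ->
  prev_low h' (if k == n then 1 else k.+1) = tau (prev_low h k).
Proof.
have [pn hp hlt] := prev_lowP hE nb; rewrite -pE in pn hp hlt.
move=> kb; have [qk hq hqlt] := prev_lowP hE kb.
case: ifP => [/eqP kn|kn].
  rewrite kn -pE /tau eqxx.
  by have [] := @prev_lowP _ _ hE' 1 isT; rewrite ltnS leqn0 => /eqP.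
move: (prev_low h k) qk hq hqlt => q qk hq hqlt.
rewrite /tau; have -> : (q == n) = false by lia. rewrite /=.
have gt0 := exc_gt0 hE.
have gt0' := exc_gt0 hE'.
case: (leqP k p) => kp.
  have -> : (q == p) = false by lia. rewrite /=.
  have hk := rotate_low kp; have hq' := @rotate_low q ltac:(lia).
  apply: (prev_low_eq hE'); try lia.
  move=> j jk. have := @rotate_low j.-1 ltac:(lia);
    have := hqlt j.-1 ltac:(lia).
  have -> : j.-1.+1 = j by lia. lia.
have hk := @rotate_high k ltac:(lia).
(* Run p has moved to the front, so every new index from 1 up to that of k must be checked, on both
   sides of p. *)
case: ifP => [/eqP qp|qp].
  apply: (prev_low_eq hE'); try lia; first by rewrite h'0 gt0' //; lia.
  move=> j jk. case: (leqP j p.+1) => jp.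
    have := @rotate_low j.-1 ltac:(lia); have -> : j.-1.+1 = j by lia.
    have : (h k <= h p.+1)%R.
      case: (altP (k =P p.+1)) => [->//|kp']; apply: ltW; apply: hqlt; lia.
    case: (posnP j.-1) => [-> | j0]; first lia.
    by have := gt0 j.-1 ltac:(lia); lia.
  have := @rotate_high j.-1 ltac:(lia); have -> : j.-1.+1 = j by lia.
  by have := hqlt j.-1 ltac:(lia); lia.
(* If q < p, then p lies between q and k, so [h k < h p], whereas [h p < h n < h k]. *)
have pq : p < q.
  case: (ltngtP p q) => // [qp'|]; last by lia.
  have := hqlt p ltac:(lia); have := hlt k ltac:(lia); lia.
have hq' := @rotate_high q ltac:(lia).
apply: (prev_low_eq hE'); try lia.
move=> j jk. have := @rotate_high j.-1 ltac:(lia); have := hqlt j.-1 ltac:(lia).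
have -> : j.-1.+1 = j by lia. lia.
Qed.

Lemma rotate_next k : 0 < k < b ->
  next_low m h' (if k == n then 1 else k.+1) = (tau (next_low m h k).-1).+1.
Proof.
have [pn hp hlt] := prev_lowP hE nb; rewrite -pE in pn hp hlt.
move=> kb; have [qk hq hqlt] := next_lowP hE kb.
have gt0 := exc_gt0 hE.
have gt0' := exc_gt0 hE'.
have hp1 : (h p < h p.+1)%R.
  by case: (altP (n =P p.+1)) => [<-//|ne]; have := hlt p.+1 ltac:(lia); lia.
have hn1 := @rotate_high p.+1 ltac:(lia).
have hpos := gt0 n nb.
case: ifP => [/eqP kn|kn].
  have -> : next_low m h k = b by rewrite kn in qk *; lia.
  rewrite /= /tau; have -> : (n == p) = false by lia. rewrite /=.
  rewrite eqxx; have h'1 := rotate_low (leq0n p).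
  have pp : (h p >= 0)%R by case: (posnP p) => [->|p0];
    [rewrite h0|apply/ltW/gt0; lia].
  apply: (next_low_eq hE'); try lia.
  move=> j jk. have := @rotate_low j.-1 ltac:(lia).
  have -> : j.-1.+1 = j by lia. have := gt0 j.-1 ltac:(lia); lia.
move: (next_low m h k) qk hq hqlt => q qk hq hqlt.
case: (leqP k p) => kp; last first.
  have qn : q <= n.
    by case: (ltnP n q) => // nq; have := hqlt n; have := hlt k; lia.
  have -> : (tau q.-1).+1 = q.+1.
    by rewrite /tau; case: ifP => [|_]; [|case: ifP]; lia.
  have hk := @rotate_high k ltac:(lia); have hq' := @rotate_high q ltac:(lia).
  apply: (next_low_eq hE'); try lia.
  move=> j jk. have := @rotate_high j.-1 ltac:(lia).
  have -> : j.-1.+1 = j by lia. have := hqlt j.-1 ltac:(lia); lia.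
have hk := rotate_low kp.
case: (leqP q p) => qp.
  have -> : (tau q.-1).+1 = q.+1.
    rewrite /tau; have -> : (q.-1 == p) = false by lia. rewrite /=.
    have -> : (q.-1 == n) = false by lia. rewrite /=; lia.
  have hq' := rotate_low qp.
  apply: (next_low_eq hE'); try lia.
  move=> j jk. have := @rotate_low j.-1 ltac:(lia).
  have -> : j.-1.+1 = j by lia. have := hqlt j.-1 ltac:(lia); lia.
have hkp : (h k <= h p)%R.
  by case: (altP (k =P p)) => [->//|kp']; apply/ltW/hqlt; lia.
(* Beyond p and up to n the level is at least [h n > h p >= h k], so it falls below [h k] only at
   b. *)
have qb : q = b.
  case: (ltngtP q b) => // qb; last lia.
  case: (altP (q =P n)) => [e|ne]; first by move: hq; rewrite e; lia.
  by have := hlt q ltac:(lia); lia.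
rewrite qb /= /tau; have -> : (n == p) = false by lia. rewrite /=.
have hk0 := gt0 k kb; rewrite eqxx; apply: (next_low_eq hE'); try lia.
move=> j jk. have := @rotate_low j.-1 ltac:(lia).
have -> : j.-1.+1 = j by lia.
by have := hqlt j.-1 ltac:(lia); lia.
Qed.
End Rotate.

(* Keeping the first run (Section Prev) or the last run (Section Next) in place
   and shifting the n others cyclically rotates the labels, as long as both
   paths are Dyck paths. *)
Section Shift.
Variable t : nat.
Hypothesis tn : t < n.
(** The rotation of labels by -t modulo n, with representatives 1, ..., n. *)
Let rl k := if k <= t then k + n - t else k - t.

Section Prev.
Let tau i := if i == 0 then 0 else rl i.
Hypothesis steps : forall i, i < b ->
  (h' (tau i).+1 - h' (tau i) = h i.+1 - h i)%R.

Let shift_low k : 0 < k <= n - t -> (h' k = h (t + k) - h t.+1 + h 1)%R.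
Proof.
elim: k => // k IH kn; case: (posnP k) => [->|k0].
  by have := @steps 0 isT; rewrite /tau /= h0 h'0 addn1; lia.
have := @steps (t + k) ltac:(lia); rewrite /tau /rl.
have -> : (t + k == 0) = false by lia. rewrite /=.
have -> : (t + k <= t) = false by lia. rewrite /=.
have -> : t + k - t = k by lia.
have -> : t + k.+1 = (t + k).+1 by lia.
by have := IH ltac:(lia); lia.
Qed.

Let shift_high i : 0 < i <= t.+1 -> (h' (n - t + i) = h i - h t.+1)%R.
Proof.
elim: i => // i IH it; case: (posnP i) => [->|i0].
  have := @steps n ltac:(lia); rewrite /tau /rl /=.
  have -> : (n <= t) = false by lia. rewrite /=.
  rewrite addn1 hb; have := @shift_low (n - t) ltac:(lia).
  have -> : t + (n - t) = n by lia.
  by lia.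
have := @steps i ltac:(lia); rewrite /tau /rl.
have -> : (i == 0) = false by lia. rewrite /=.
have -> : (i <= t) by lia.
have -> : i + n - t = n - t + i by lia.
have -> : n - t + i.+1 = (n - t + i).+1 by lia.
by have := IH ltac:(lia); lia.
Qed.

(** The hypotheses are positivity of h' on two arcs: the indices after t come first, raised by the
    fixed first step [h 1], and the indices 1, ..., t come last. *)
Lemma shift_prev_gt0 :
  (forall k, t < k < b -> (0 < h k - h t.+1 + h 1)%R) ->
  (forall k, 0 < k <= t -> (h t.+1 < h k)%R) ->
  forall i, 0 < i < b -> (0 < h' i)%R.
Proof.
move=> hlow hhigh i ib; case: (leqP i (n - t)) => it.
  by have := @shift_low i ltac:(lia); have := hlow (t + i) ltac:(lia); lia.
have := @shift_high (i - (n - t)) ltac:(lia); rewrite subnKC; last lia.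
by have := hhigh (i - (n - t)) ltac:(lia); lia.
Qed.

Hypotheses (hE : excursion m h) (hE' : excursion m h').

Let htmin i : 0 < i <= t -> (h t.+1 < h i)%R.
Proof.
move=> it; have := shift_high (_ : 0 < i <= t.+1) => /(_ ltac:(lia)).
by have := @exc_gt0 _ _ hE' (n - t + i) ltac:(lia); lia.
Qed.

Lemma shift_prev_prev k : 0 < k < b -> prev_low h' (rl k) = tau (prev_low h k).
Proof.
move=> kb; have [qk hq hqlt] := prev_lowP hE kb.
have gt0 := exc_gt0 hE.
have gt0' := exc_gt0 hE'.
move: (prev_low h k) qk hq hqlt => q qk hq hqlt.
rewrite /tau {1}/rl; case: leqP => kt.
  have -> : k + n - t = n - t + k by lia.
  have hk := @shift_high k ltac:(lia).
  case: (posnP q) => [q0|q0].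
    apply: (prev_low_eq hE'); try lia; first by rewrite h'0 gt0' //; lia.
    move=> j jk. case: (leqP j (n - t)) => jt.
      have := @shift_low j ltac:(lia); have := gt0 (t + j) ltac:(lia).
      have : (h k <= h 1)%R; last by lia.
      by case: (altP (k =P 1)) => [->//|k1]; apply/ltW/hqlt; lia.
    have := @shift_high (j - (n - t)) ltac:(lia).
    by rewrite subnKC; try lia; have := hqlt (j - (n - t)) ltac:(lia); lia.
  have := @shift_high q ltac:(lia); rewrite /rl;
    have -> : q <= t by lia. rewrite /=.
  have -> : q + n - t = n - t + q by lia.
  move=> hq'; apply: (prev_low_eq hE'); try lia.
  move=> j jk. have := @shift_high (j - (n - t)) ltac:(lia).
  by rewrite subnKC; try lia; have := hqlt (j - (n - t)) ltac:(lia); lia.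
have := @shift_low (k - t) ltac:(lia); rewrite subnKC; last lia.
move=> hk; case: (posnP q) => [q0|q0].
  apply: (prev_low_eq hE'); try lia; first by rewrite h'0 gt0' //; lia.
  move=> j jk. have := @shift_low j ltac:(lia).
  by have := hqlt (t + j) ltac:(lia); lia.
(* A previous lower index in 1, ..., t would have level above [h t.+1], which is at least [h k]. *)
have qt : t < q.
  rewrite ltnNge; apply/negP => qt; have := htmin (_ : 0 < q <= t).
  rewrite q0 qt => /(_ isT).
  have : (h k <= h t.+1)%R; last lia.
  by case: (altP (k =P t.+1)) => [->//|k1]; apply/ltW/hqlt; lia.
rewrite /rl; have -> : (q <= t) = false by lia. rewrite /=.
have := @shift_low (q - t) ltac:(lia); rewrite subnKC; last lia.
move=> hq'; apply: (prev_low_eq hE'); try lia.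
move=> j jk. have := @shift_low j ltac:(lia).
by have := hqlt (t + j) ltac:(lia); lia.
Qed.

Lemma shift_prev_next k : 0 < k < b ->
  next_low m h' (rl k) = (tau (next_low m h k).-1).+1.
Proof.
move=> kb; have [qk hq hqlt] := next_lowP hE kb.
have gt0 := exc_gt0 hE.
have gt0' := exc_gt0 hE'.
move: (next_low m h k) qk hq hqlt => q qk hq hqlt.
rewrite /tau {1}/rl; have -> : (q.-1 == 0) = false by lia. rewrite /=.
case: (leqP k t) => kt.
  have -> : k + n - t = n - t + k by lia.
  have hk := @shift_high k ltac:(lia).
  have qt : q <= t.+1.
    rewrite leqNgt; apply/negP => qt; have := hqlt t.+1; have := @htmin k; lia.
  have -> : (rl q.-1).+1 = n - t + q by rewrite /rl; case: leqP; lia.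
  have hq' := @shift_high q ltac:(lia).
  apply: (next_low_eq hE'); try lia.
  move=> j jk. have := @shift_high (j - (n - t)) ltac:(lia).
  by rewrite subnKC; try lia; have := hqlt (j - (n - t)) ltac:(lia); lia.
have -> : (rl q.-1).+1 = q - t by rewrite /rl; case: leqP; lia.
have := @shift_low (k - t) ltac:(lia); rewrite subnKC; last lia.
move=> hk.
(* For q = b the path goes on after the old last run with the old index 1, and the drop is
   [h k > 0]. *)
have hq' : (h' (q - t) < h' (k - t))%R.
  case: (leqP q n) => qn.
    have := @shift_low (q - t) ltac:(lia); rewrite subnKC; last lia.
    by lia.
  have -> : q - t = n - t + 1 by lia.
  by have := @shift_high 1 ltac:(lia); have := gt0 k kb; lia.
apply: (next_low_eq hE'); try lia.
move=> j jk. have := @shift_low j ltac:(lia).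
by have := hqlt (t + j) ltac:(lia); lia.
Qed.
End Prev.

Section Next.
Let tau i := if i == n then n else if i < t then i + n - t else i - t.
Hypothesis steps : forall i, i < b ->
  (h' (tau i).+1 - h' (tau i) = h i.+1 - h i)%R.

Let shift_low k : k <= n - t -> (h' k = h (t + k) - h t)%R.
Proof.
elim: k => [_|k IH kn]; first by rewrite addn0 h'0; lia.
have := @steps (t + k) ltac:(lia); rewrite /tau.
have -> : (t + k == n) = false by lia. rewrite /=.
have -> : (t + k < t) = false by lia. rewrite /=.
have -> : t + k - t = k by lia.
have -> : t + k.+1 = (t + k).+1 by lia.
by have := IH ltac:(lia); lia.
Qed.

Let shift_high i : i <= t -> (h' (n - t + i) = h i + h n - h t)%R.
Proof.
elim: i => [_|i IH it].
  rewrite addn0 shift_low // subnKC ?h0; lia.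
have := @steps i ltac:(lia); rewrite /tau.
have -> : (i == n) = false by lia. rewrite /=.
have -> : (i < t) by lia. rewrite /=.
have -> : i + n - t = n - t + i by lia.
have -> : n - t + i.+1 = (n - t + i).+1 by lia.
by have := IH ltac:(lia); lia.
Qed.

(** Here the path starts anew at t: levels after t are measured from [h t], and the indices 1, ...,
    t come after them, raised by [h n]. *)
Lemma shift_next_gt0 :
  (forall k, t < k < b -> (h t < h k)%R) ->
  (forall k, 0 < k <= t -> (0 < h k + h n - h t)%R) ->
  forall i, 0 < i < b -> (0 < h' i)%R.
Proof.
move=> hlow hhigh i ib; case: (leqP i (n - t)) => it.
  by have := @shift_low i ltac:(lia); have := hlow (t + i) ltac:(lia); lia.
have := @shift_high (i - (n - t)) ltac:(lia); rewrite subnKC; last lia.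
by have := hhigh (i - (n - t)) ltac:(lia); lia.
Qed.

Hypotheses (hE : excursion m h) (hE' : excursion m h').

Let htmin i : t < i <= n -> (h t < h i)%R.
Proof.
move=> it; have := @shift_low (i - t) ltac:(lia); rewrite subnKC; last lia.
by have := @exc_gt0 _ _ hE' (i - t) ltac:(lia); lia.
Qed.

Lemma shift_next_prev k : 0 < k < b -> prev_low h' (rl k) = tau (prev_low h k).
Proof.
move=> kb; have [qk hq hqlt] := prev_lowP hE kb.
have gt0 := exc_gt0 hE.
have gt0' := exc_gt0 hE'.
move: (prev_low h k) qk hq hqlt => q qk hq hqlt.
rewrite /tau {1}/rl; have -> : (q == n) = false by lia. rewrite /=.
case: (leqP k t) => kt.
  have -> : k + n - t = n - t + k by lia.
  have hk := @shift_high k ltac:(lia).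
  have -> : (q < t) by lia. rewrite /=.
  have := @shift_high q ltac:(lia).
  have -> : q + n - t = n - t + q by lia.
  move=> hq'; apply: (prev_low_eq hE'); try lia.
  move=> j jk. have := @shift_high (j - (n - t)) ltac:(lia).
  by rewrite subnKC; try lia; have := hqlt (j - (n - t)) ltac:(lia); lia.
have := @shift_low (k - t) ltac:(lia); rewrite subnKC; last lia.
move=> hk; have qt : t <= q.
  by rewrite leqNgt; apply/negP => qt; have := htmin (_ : t < k <= n);
    have := hqlt t; lia.
have -> : (q < t) = false by lia. rewrite /=.
have := @shift_low (q - t) ltac:(lia); rewrite subnKC; last lia.
move=> hq'; apply: (prev_low_eq hE'); try lia.
move=> j jk. have := @shift_low j ltac:(lia).
by have := hqlt (t + j) ltac:(lia); lia.
Qed.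

Lemma shift_next_next k : 0 < k < b ->
  next_low m h' (rl k) = (tau (next_low m h k).-1).+1.
Proof.
move=> kb; have [qk hq hqlt] := next_lowP hE kb.
have gt0 := exc_gt0 hE.
have gt0' := exc_gt0 hE'.
move: (next_low m h k) qk hq hqlt => q qk hq hqlt.
rewrite /tau {1}/rl.
case: (leqP k t) => kt.
  have -> : k + n - t = n - t + k by lia.
  have hk := @shift_high k ltac:(lia).
  case: (leqP q t) => qt.
    have -> : (q.-1 == n) = false by lia. rewrite /=.
    have -> : (q.-1 < t) by lia. rewrite /=.
    have -> : (q.-1 + n - t).+1 = n - t + q by lia.
    have hq' := @shift_high q ltac:(lia).
    apply: (next_low_eq hE'); try lia.
    move=> j jk. have := @shift_high (j - (n - t)) ltac:(lia).
    by rewrite subnKC; try lia; have := hqlt (j - (n - t)) ltac:(lia); lia.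
  have hkt : (h k <= h t)%R.
    by case: (altP (k =P t)) => [->//|k1]; apply/ltW/hqlt; lia.
  (* Positivity of h' keeps the levels of t+1, ..., n above [h t >= h k]. *)
  have qb : q = b.
    by case: (ltngtP q b) => // qb; [have := @htmin q ltac:(lia)|]; lia.
  rewrite qb /= eqxx; apply: (next_low_eq hE'); try lia.
    by rewrite (excb hE') gt0' //; lia.
  move=> j jk. have := @shift_high (j - (n - t)) ltac:(lia).
  by rewrite subnKC; try lia; have := hqlt (j - (n - t)) ltac:(lia); lia.
have := @shift_low (k - t) ltac:(lia); rewrite subnKC; last lia.
move=> hk; case: (leqP q n) => qn.
  have -> : (q.-1 == n) = false by lia. rewrite /=.
  have -> : (q.-1 < t) = false by lia. rewrite /=.
  have -> : (q.-1 - t).+1 = q - t by lia.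
  have := @shift_low (q - t) ltac:(lia); rewrite subnKC; last lia.
  move=> hq'; apply: (next_low_eq hE'); try lia.
  move=> j jk. have := @shift_low j ltac:(lia).
  by have := hqlt (t + j) ltac:(lia); lia.
have qb : q = b by lia.
rewrite qb /= eqxx; apply: (next_low_eq hE'); try lia.
  by rewrite (excb hE') gt0' //; lia.
move=> j jk. case: (leqP j (n - t)) => jt.
  by have := @shift_low j ltac:(lia); have := hqlt (t + j) ltac:(lia); lia.
have hkn : (h k <= h n)%R.
  by case: (altP (k =P n)) => [->//|k1]; apply/ltW/hqlt; lia.
have := @shift_high (j - (n - t)) ltac:(lia); rewrite subnKC; last lia.
by have := gt0 (j - (n - t)) ltac:(lia); lia.
Qed.
End Next.
End Shift.
End Recenter.

(** * Extrema and rotations of sets of labels *)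

(** The bound on [lab x] reflects that the fold defining [min_label] starts from b. *)
Lemma min_labelE b (B : {set label b}) (x : label b) :
  x \in B -> (forall y, y \in B -> x <= y) -> lab x <= b -> min_label B = lab x.
Proof.
move=> xB xmin xb; apply/eqP; rewrite eqn_leq /min_label; apply/andP; split.
  have := mem_index_enum x; elim: index_enum => // y r IH.
  rewrite inE big_cons => /orP[/eqP <-|/IH xr]; first by rewrite xB geq_minl.
  by case: ifP => // _; rewrite geq_min xr orbT.
apply: (big_ind (fun z => lab x <= z)) => [//|y z xy xz|y yB];
  first by rewrite leq_min xy.
by rewrite /lab ltnS xmin.
Qed.

Lemma max_labelE b (B : {set label b}) (x : label b) :
  x \in B -> (forall y, y \in B -> y <= x) -> max_label B = lab x.
Proof.
move=> xB xmax; apply/eqP;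
  rewrite eqn_leq /max_label (bigop.leq_bigmax_cond _ xB) andbT.
by apply/bigop.bigmax_leqP => y yB; rewrite /lab ltnS xmax.
Qed.

Lemma mem_rot_set b (k i : label b) (B : {set label b}) :
  (i \in rot_set k B) = ((i - k)%R \in B).
Proof.
apply/imsetP/idP => [[j jB ->]|iB]; first by rewrite addrK.
by exists (i - k)%R => //; rewrite subrK.
Qed.

Lemma rot_set0 b (B : {set label b}) : rot_set 0%R B = B.
Proof. by apply/setP => i; rewrite mem_rot_set subr0. Qed.

Lemma rot_setD b (k l : label b) (B : {set label b}) :
  rot_set (k + l)%R B = rot_set k (rot_set l B).
Proof. by apply/setP => i; rewrite !mem_rot_set opprD addrA. Qed.

(** * Blocks of an excursion: indexing by runs, noncrossing, invariant blocks *)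

Section Blocks.
Variable m : nat.
Local Notation b := m.+2.
Local Notation n := m.+1.
Implicit Types (h : nat -> int) (i j k : nat).

Lemma lab_bound (k : label b) : 0 < lab k < b.
Proof. by rewrite /lab /= ltnS (ltn_ord k). Qed.

Lemma labP k : 0 < k < b -> exists x : label b, lab x = k.
Proof.
case: k => // k kb; have kn : k < n by lia.
by exists (Ordinal kn).
Qed.

Section Excursion.
Variables (h : nat -> int) (hE : excursion m h).

Lemma step_neq0 i : i < b -> (h i < h i.+1)%R = ~~ (h i.+1 < h i)%R.
Proof.
move=> ib; rewrite -leNgt lt_neqAle andb_idl // => _.
apply/eqP => e; case: (altP (i =P n)) => [en|ne].
  by have := exc_gt0 hE (_ : 0 < n < b) => /(_ ltac:(lia));
    rewrite -en e en (excb hE).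
by have := exc_inj hE ib (_ : i.+1 < b) e => /(_ ltac:(lia)); lia.
Qed.

Lemma prev_low_step k : 0 < k < b -> (h (prev_low h k) < h (prev_low h k).+1)%R.
Proof.
move=> kb; have [pk hp hlt] := prev_lowP hE kb.
case: (altP ((prev_low h k).+1 =P k)) => [->//|ne].
by apply: (lt_trans hp); apply: hlt; lia.
Qed.

Lemma next_low_step k : 0 < k < b ->
  (h (next_low m h k) < h (next_low m h k).-1)%R.
Proof.
move=> kb; have [pk hp hlt] := next_lowP hE kb.
case: (altP ((next_low m h k).-1 =P k)) => [->//|ne].
by apply: (lt_trans hp); apply: hlt; lia.
Qed.

Lemma prev_block (k : label b) :
  vertex_block m h (prev_low h (lab k)) =
  inl [set j : label b | prev_low h (lab j) == prev_low h (lab k)] :> tblock b.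
Proof. by rewrite /vertex_block prev_low_step // lab_bound. Qed.

Lemma next_block (k : label b) :
  vertex_block m h (next_low m h (lab k)).-1 =
  inr [set j : label b | next_low m h (lab j) == next_low m h
    (lab k)] :> tblock b.
Proof.
have kb := lab_bound k; have := next_low_step kb.
have [kn _ _] := next_lowP hE kb.
have -> : next_low m h (lab k) = (next_low m h (lab k)).-1.+1 by lia.
rewrite /vertex_block step_neq0; last by lia.
by move=> ->.
Qed.

(** An ascent at i is seen by label i+1 and a descent at i by label i, so every run owns a nonempty
    block. *)
Lemma vertex_blockP i : i < b ->
  (exists2 k : label b, prev_low h (lab k) = i &
     lab k = i.+1 /\ (h i < h i.+1)%R) \/
  (exists2 k : label b, (next_low m h (lab k)) = i.+1 &
     lab k = i /\ (h i < h i.+1)%R = false).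
Proof.
move=> ib; have := step_neq0 ib; case: (boolP (h i < h i.+1)%R) => hi hs.
  have i1 : 0 < i.+1 < b.
    have : i != n; last lia.
    apply/eqP => en; move: hi; rewrite en (excb hE).
    by have := exc_gt0 hE (_ : 0 < n < b) => /(_ ltac:(lia)); lia.
  have [k ki] := labP i1; left; exists k; rewrite ki //.
  by apply: (prev_low_eq hE); try lia; move=> j jj; lia.
have i1 : 0 < i < b.
  have : i != 0; last lia.
  apply/eqP => en; move: hi; rewrite en (exc0 hE).
  by have := exc_gt0 hE (_ : 0 < 1 < b) => /(_ ltac:(lia)) ->.
have [k ki] := labP i1; right; exists k; rewrite ki //.
by apply: (next_low_eq hE); try lia; move=> j jj; lia.
Qed.

(** Label i+1 is the least of its P-class because a previous lower index is smaller than the label;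
    label i is the largest of its Q-class for the mirrored reason. *)
Lemma vertex_blockK i : i < b -> block_index (vertex_block m h i) = i.
Proof.
move=> ib; rewrite /vertex_block.
case: (vertex_blockP ib) => -[k ki [ki1 ->]] /=.
  rewrite (@min_labelE _ _ k) ?ki1 ?inE ?ki //.
  move=> y; rewrite inE => /eqP yi.
  have [] := prev_lowP hE (lab_bound y); rewrite yi => iy _ _.
  by rewrite -ltnS -/(lab _) ki1.
rewrite (@max_labelE _ _ k) ?inE ?ki // => y; rewrite inE => /eqP yi.
have [] := next_lowP hE (lab_bound y); rewrite yi => iy _ _.
by rewrite -ltnS -/(lab k) ki1; rewrite /lab in iy *; lia.
Qed.

Lemma vertex_block_inj i j : i < b -> j < b ->
  vertex_block m h i = vertex_block m h j :> tblock b -> i = j.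
Proof. by move=> ib jb e; rewrite -(vertex_blockK ib) e vertex_blockK. Qed.

(** Noncrossing of P. The interleaving forces [h k4 < h k3 < h k2], and then the larger of the two
    previous lower indices is a closer lower index for the other class. *)
Lemma prev_cross k1 k2 k3 k4 : 0 < k1 -> k1 < k2 < k3 -> k3 < k4 < b ->
  prev_low h k1 = prev_low h k3 -> prev_low h k2 = prev_low h k4 ->
  prev_low h k1 = prev_low h k2.
Proof.
move=> k0 k23 k4b e13 e24.
have [p1 hp1 hl1] := @prev_lowP _ _ hE k1 ltac:(lia).
have [p2 hp2 hl2] := @prev_lowP _ _ hE k2 ltac:(lia).
have [p3 hp3 hl3] := @prev_lowP _ _ hE k3 ltac:(lia).
have [p4 hp4 hl4] := @prev_lowP _ _ hE k4 ltac:(lia).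
have h43 := hl4 k3 ltac:(lia); have h32 := hl3 k2 ltac:(lia).
case: (ltngtP (prev_low h k1) (prev_low h k2)) => // c.
  have := hl3 (prev_low h k4) ltac:(lia); lia.
have := hl2 (prev_low h k3) ltac:(lia); lia.
Qed.

Lemma next_cross k1 k2 k3 k4 : 0 < k1 -> k1 < k2 < k3 -> k3 < k4 < b ->
  next_low m h k1 = next_low m h k3 -> next_low m h k2 = next_low m h k4 ->
  next_low m h k1 = next_low m h k2.
Proof.
move=> k0 k23 k4b e13 e24.
have [p1 hp1 hl1] := @next_lowP _ _ hE k1 ltac:(lia).
have [p2 hp2 hl2] := @next_lowP _ _ hE k2 ltac:(lia).
have [p3 hp3 hl3] := @next_lowP _ _ hE k3 ltac:(lia).
have [p4 hp4 hl4] := @next_lowP _ _ hE k4 ltac:(lia).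
have h12 := hl1 k2 ltac:(lia); have h23 := hl2 k3 ltac:(lia).
case: (ltngtP (next_low m h k1) (next_low m h k2)) => // c.
  have := hl2 (next_low m h k1) ltac:(lia); lia.
have := hl3 (next_low m h k2) ltac:(lia); lia.
Qed.

(** Excludes an invariant block of P alongside one of Q. If x <= y, the P-pair gives
    [h (x + g) < h y] and the Q-pair the opposite. If y < x, the next lower index of y is at most x
    + g and lies below the level that the P-pair allows there. *)
Lemma prev_next_cross x y g : 0 < x <= g -> 0 < y <= g -> x + g < b ->
  y + g < b ->
  prev_low h x = prev_low h (x + g) ->
    next_low m h y = next_low m h (y + g) -> False.
Proof.
move=> xg yg xb yb ex ey.
have [p1 hp1 hl1] := @prev_lowP _ _ hE x ltac:(lia).
have [p2 hp2 hl2] := @prev_lowP _ _ hE (x + g) ltac:(lia).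
have [p3 hp3 hl3] := @next_lowP _ _ hE y ltac:(lia).
have [p4 hp4 hl4] := @next_lowP _ _ hE (y + g) ltac:(lia).
case: (leqP x y) => xy.
  by have := hl3 (x + g) ltac:(lia); have := hl2 y ltac:(lia); lia.
have hxy := hl3 x ltac:(lia).
have nx : next_low m h y <= x + g.
  rewrite leqNgt; apply/negP => nx.
  by have := hl4 (x + g) ltac:(lia); have := hl2 (y + g) ltac:(lia); lia.
have yx : y <= prev_low h x.
  by rewrite leqNgt; apply/negP => c; have := hl1 y ltac:(lia); lia.
have hz : (h y <= h (prev_low h x))%R.
  case: (altP (y =P prev_low h x)) => [<-//|ne].
  by apply/ltW/hl3; lia.
rewrite -ex in hp2 hl2; case: (altP (next_low m h y =P x + g)) => [e'|ne'].
  by rewrite e' in hp3; lia.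
by have := hl2 (next_low m h y) ltac:(lia); lia.
Qed.

End Excursion.

Section Transfer.
Variables (h h' : nat -> int) (hE : excursion m h) (hE' : excursion m h').
Variables (t : label b) (tau : nat -> nat).
Hypothesis tauI : forall i j, i < b -> j < b -> tau i = tau j -> i = j.
Hypothesis steps : forall i, i < b ->
  (h' (tau i).+1 - h' (tau i) = h i.+1 - h i)%R.
Hypothesis prevE : forall k : label b,
  prev_low h' (lab (k + t)%R) = tau (prev_low h (lab k)).
Hypothesis nextE : forall k : label b,
  next_low m h' (lab (k + t)%R) = (tau (next_low m h (lab k)).-1).+1.

(** Common last step of all rotations: [steps] makes tau preserve ascents and descents, hence the
    side of a block, and the two matching hypotheses carry its labels. *)
Lemma vertex_block_transfer i : i < b ->
  vertex_block m h' (tau i) = rot_block t (vertex_block m h i) :> tblock b.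
Proof.
move=> ib; have e := steps ib; rewrite /vertex_block.
have -> : (h' (tau i) < h' (tau i).+1)%R = (h i < h i.+1)%R by lia.
case: ifP => _ /=; congr (_ _); apply/setP => k';
  pose k : label b := (k' - t)%R;
  (have -> : k' = (k + t)%R by rewrite subrK);
  rewrite (@mem_rot_set b) addrK !inE.
  have [pk _ _] := prev_lowP hE (lab_bound k).
  have pb : prev_low h (lab k) < b by have := lab_bound k; lia.
  by rewrite prevE; apply/eqP/eqP => [/(tauI pb ib) ->|->].
have [nb _ _] := next_lowP hE (lab_bound k).
have pb : (next_low m h (lab k)).-1 < b by lia.
rewrite nextE; apply/eqP/eqP => [[/(tauI pb ib) <-]|-> //].
by lia.
Qed.
End Transfer.

Lemma rot_set_mulrn (s : label b) (B : {set label b}) k :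
  rot_set s B = B -> rot_set (s *+ k)%R B = B.
Proof.
move=> e; elim: k => [|k IH]; first by rewrite mulr0n rot_set0.
by rewrite mulrS rot_setD IH.
Qed.

(** By Bezout, B is invariant under g = gcd(s, n), a proper divisor of n because s is nonzero. So 2g
    <= n, the least element of B is below g, and adding g to it does not wrap around. *)
Lemma rot_fixed_pair (s : label b) (B : {set label b}) (x0 : label b) :
  s != 0%R -> x0 \in B -> rot_set s B = B ->
  exists2 x : label b, x < gcdn s n &
    x \in B /\ exists2 y : label b, lab y = lab x + gcdn s n & y \in B.
Proof.
move=> s0 x0B sB; set g := gcdn s n.
have sgt0 : 0 < s by rewrite lt0n.
have gn : g < n.
  by apply: leq_ltn_trans (ltn_ord s); apply: dvdn_leq (dvdn_gcdl _ _).
pose g' : label b := Ordinal gn.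
have gB : rot_set g' B = B.
  have [km kn ekm _] := egcdnP n sgt0.
  have -> : g' = (s *+ km)%R; last exact: rot_set_mulrn.
  apply: val_inj => /=; rewrite Zp_mulrn /= mulnC ekm -/g.
  by rewrite modnMDl modn_small.
have g2 : g + g <= n.
  have /dvdnP[q qE] : g %| n by apply: dvdn_gcdr.
  by case: q qE => [|[|q]]; rewrite ?mul0n ?mul1n ?mulSn; lia.
have [x xB xmin] := arg_minnP (fun i : label b => nat_of_ord i) x0B.
have xg : x < g.
  rewrite ltnNge; apply/negP => gx.
  have xgn : x - g < n by have := ltn_ord x; lia.
  have e : Ordinal xgn = (x - g')%R.
    apply/eqP; rewrite eq_sym subr_eq; apply/eqP/val_inj => /=.
    by rewrite subnK // modn_small // ltn_ord.
  have /xmin /= : Ordinal xgn \in B by rewrite e -(@mem_rot_set b) gB.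
  have g0 : 0 < g by rewrite gcdn_gt0 sgt0.
  by rewrite leqNgt ltn_subrL g0 (leq_trans g0 gx).
exists x => //; split=> //; exists (x + g')%R;
  last by rewrite -gB (@mem_rot_set b) addrK.
by rewrite /lab /= modn_small ?addSn // (leq_trans _ g2) // ltn_add2r.
Qed.

(** Each invariant block supplies labels x and x + g with 1 <= x <= g. Two such pairs interleave or
    coincide, and the crossing lemmas leave only equality. *)
Lemma rot_fixed_unique (h : nat -> int) (hE : excursion m h) (s : label b) i j :
  s != 0%R -> i < b -> j < b ->
  rot_block s (vertex_block m h i) = vertex_block m h i ->
  rot_block s (vertex_block m h j) = vertex_block m h j -> i = j.
Proof.
move=> s0 ib jb; rewrite /vertex_block.
set g := gcdn s n.
have pairP i' : i' < b -> (h i' < h i'.+1)%R ->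
    rot_set s [set k : label b | prev_low h (lab k) == i'] =
      [set k : label b | prev_low h (lab k) == i'] ->
    exists x, [/\ 0 < x <= g, x + g < b, prev_low h x =
      i' & prev_low h (x + g) = i'].
  move=> i'b hi; have [[k ki _] sB|[k _ [_]]] := vertex_blockP hE i'b;
    last by rewrite hi.
  have kB : k \in [set k : label b | prev_low h (lab k) == i']
    by rewrite inE ki.
  have [x xg [xB [y yx yB]]] := rot_fixed_pair s0 kB sB.
  move: xB yB; rewrite !inE yx => /eqP xB /eqP yB.
  by exists (lab x); split => //; rewrite -yx; have := lab_bound y; lia.
have pairQ i' : i' < b -> (h i' < h i'.+1)%R = false ->
    rot_set s [set k : label b | next_low m h (lab k) == i'.+1] =
      [set k : label b | next_low m h (lab k) == i'.+1] ->
    exists x, [/\ 0 < x <= g, x + g < b, next_low m h x = i'.+1 & next_low m h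
      (x + g) = i'.+1].
  move=> i'b hi; have [[k _ [_]]|[k ki _] sB] := vertex_blockP hE i'b;
    first by rewrite hi.
  have kB : k \in [set k : label b | next_low m h (lab k) == i'.+1]
    by rewrite inE ki.
  have [x xg [xB [y yx yB]]] := rot_fixed_pair s0 kB sB.
  move: xB yB; rewrite !inE yx => /eqP xB /eqP yB.
  by exists (lab x); split => //; rewrite -yx; have := lab_bound y; lia.
case: ifP => hi; case: ifP => hj [eB] [eC].
- have [x [xg xb ex ex']] := pairP i ib hi eB.
  have [y [yg yb ey ey']] := pairP j jb hj eC.
  rewrite -ex -ey; case: (ltngtP x y) => [xy|yx|->//].
    by apply: (@prev_cross h hE x y (x + g) (y + g)); lia.
  by symmetry; apply: (@prev_cross h hE y x (y + g) (x + g)); lia.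
- have [x [xg xb ex ex']] := pairP i ib hi eB.
  have [y [yg yb ey ey']] := pairQ j jb hj eC.
  by have [] := @prev_next_cross h hE x y g xg yg xb yb; lia.
- have [x [xg xb ex ex']] := pairQ i ib hi eB.
  have [y [yg yb ey ey']] := pairP j jb hj eC.
  by have [] := @prev_next_cross h hE y x g yg xg yb xb; lia.
have [x [xg xb ex ex']] := pairQ i ib hi eB.
have [y [yg yb ey ey']] := pairQ j jb hj eC.
apply: succn_inj; rewrite -ex -ey; case: (ltngtP x y) => [xy|yx|->//].
  by apply: (@next_cross h hE x y (x + g) (y + g)); lia.
by symmetry; apply: (@next_cross h hE y x (y + g) (x + g)); lia.
Qed.
End Blocks.

(** * Blocks of a Dyck path *)

Section PathBlocks.
Variables a m : nat.
Local Notation b := m.+2.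
Local Notation n := m.+1.
Variable D : b.-tuple 'I_a.+1.

Definition level (i : nat) : int := ((b * height D i)%:Z - (a * i)%:Z)%R.

Lemma heightS i : height D i.+1 = height D i + run D i.
Proof. by rewrite /height big_nat_recr. Qed.

Lemma levelS i : (level i.+1 = level i + (b * run D i)%:Z - a%:Z)%R.
Proof. by rewrite /level heightS mulnDr mulnS; lia. Qed.

Hypotheses (a_gt0 : 0 < a) (co_ab : coprime a b).

(** Modulo b the level of i is -a i, and a is invertible modulo b. *)
Lemma level_inj_mod i j : level i = level j -> i = j %[mod b].
Proof.
rewrite /level => e.
wlog ij : i j e / i <= j.
  by move=> H; case: (leqP i j) => [/H->//|/ltnW /H ->].
apply/eqP; rewrite eq_sym eqn_mod_dvd // -(@Gauss_dvdr _ a) 1?coprime_sym //.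
rewrite mulnBr; have -> : a * j - a * i = b * (height D j - height D i).
  by rewrite mulnBr; have := leq_mul (leqnn a) ij; lia.
exact: dvdn_mulr.
Qed.

Hypothesis dyckD : is_dyck D.

Lemma path_excursion : excursion m level.
Proof.
have [/eqP hb /forallP hD] := andP dyckD.
have inj i j : i < b -> j < b -> level i = level j -> i = j.
  by move=> ib jb /level_inj_mod; rewrite !modn_small.
split=> //; first by rewrite /level /height big_geq // !muln0.
  by rewrite /level hb mulnC; lia.
move=> i /andP[i0 ib]; have ib' : i < b.+1 by lia.
have := hD (Ordinal ib') => /= hi.
have : level i <> level 0 by move=> e; have := inj i 0 ib isT e; lia.
by rewrite {2}/level /height big_geq // /level; lia.
Qed.
Let hE := path_excursion.

(** In terms of levels a laser is horizontal: it first meets the path on the east step during which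
    the level falls below that of its label. *)
Lemma in_lasers (i j : label b) : ((i, j) \in lasers D) =
  (0 < run D (lab i)) && (next_low m level (lab i) == (lab j).+1).
Proof.
have ib := lab_bound i; have jb := lab_bound j.
have [/andP[kn nb] hn hl] := next_lowP hE ib.
rewrite /lasers inE /=; case: posnP => //= v0.
have cE x : lab i <= x < b -> crosses D (lab i) x ->
  (level x.+1 < level (lab i))%R.
  move=> /andP[ix xb]; rewrite /crosses ix /= => /andP[_].
  have : a * (x.+1 - lab i) = a * x.+1 - a * lab i by rewrite mulnBr.
  have : a * lab i <= a * x.+1 by apply: leq_mul => //; lia.
  by rewrite /level; lia.
have cN : crosses D (lab i) (next_low m level (lab i)).-1.
  set x := (next_low m level (lab i)).-1.
  have xE : next_low m level (lab i) = x.+1 by rewrite /x; lia.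
  rewrite xE in kn nb hn hl; rewrite /crosses ltnS in kn *; rewrite kn /=.
  have h1 : a * (x.+1 - lab i) = a * x.+1 - a * lab i by rewrite mulnBr.
  have h2 : a * (x - lab i) = a * x - a * lab i by rewrite mulnBr.
  have h3 : a * lab i <= a * x by apply: leq_mul.
  have h4 : a * x.+1 = a * x + a by rewrite mulnS addnC.
  (* [level x.+1 + a] is the level at the start of the east step. It exceeds [level i]: at x = i
     because the run is positive, later because [level x] already does. *)
  have : (level x.+1 + a%:Z > level (lab i))%R.
    rewrite levelS; case: (altP (x =P lab i)) => [->|ne].
      have : 0 < b * run D (lab i) by rewrite muln_gt0.
      lia.
    by have := hl x ltac:(lia); lia.
  by move: hn; rewrite /level; lia.
apply/andP/eqP => [[cj /forallP jmin]|nE].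
  have ij : lab i <= lab j by case/andP: cj.
  have := cE (lab j) ltac:(lia) cj => hj.
  case: (ltngtP (next_low m level (lab i)) (lab j).+1) => // c; last first.
    by have := hl (lab j).+1 ltac:(lia); lia.
  have [k kE] := @labP m (next_low m level (lab i)).-1 ltac:(lia).
  have := jmin k; rewrite /= kE cN implybF => /negP[].
  by suff : lab k < lab j by []; lia.
split; first by have -> : lab j = (next_low m level (lab i)).-1 by rewrite nE.
have jmin (k : label b) : lab k < lab j -> crosses D (lab i) (lab k) -> False.
  move=> kj ck; have ik : lab i <= lab k by case/andP: (ck).
  have kb := lab_bound k.
  by have := cE (lab k) ltac:(lia) ck; have := hl (lab k).+1 ltac:(lia); lia.
by apply/forallP => k; apply/implyP => kj; apply/negP; apply: jmin.
Qed.

Lemma run0_next i : 0 < i < b -> val (run D i) = 0 -> next_low m level i = i.+1.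
Proof.
move=> ib v0; apply: (next_low_eq hE) => //; try lia.
by rewrite levelS v0 muln0; lia.
Qed.

(** The laser of k covers exactly the labels strictly between k and its next lower index. Labels
    with the same previous lower index are covered by the same lasers. *)
Lemma PrelP (i j : label b) :
  Prel D i j = (prev_low level (lab i) == prev_low level (lab j)).
Proof.
have ib := lab_bound i; have jb := lab_bound j.
have aboveE (k l x : label b) : (k, l) \in lasers D ->
    above D (k, l) x = (lab k < lab x < next_low m level (lab k)).
  rewrite in_lasers => /andP[_ /eqP nE]; rewrite nE ltnS /above /=.
  case: (boolP (lab k < lab x <= lab l)) => //= /andP[kx xl].
  have [_ _ /(_ (lab x))] := next_lowP hE (lab_bound k).
  rewrite nE ltnS kx xl => /(_ isT).
  have : a * (lab x - lab k) = a * lab x - a * lab k by rewrite mulnBr.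
  have : a * lab k <= a * lab x by apply: leq_mul => //; lia.
  by rewrite /level; lia.
have prev_above (x y k : label b) : prev_low level (lab x) =
  prev_low level (lab y) ->
    lab k < lab x < next_low m level (lab k) ->
      lab k < lab y < next_low m level (lab k).
  move=> e /andP[kx xn].
  have [px hx lx] := prev_lowP hE (lab_bound x).
  have [py hy ly] := prev_lowP hE (lab_bound y).
  have [/andP[pk nb] hk lk] := next_lowP hE (lab_bound k).
  have hkx := lk (lab x) ltac:(lia).
  have kp : lab k <= prev_low level (lab x).
    by rewrite leqNgt; apply/negP => c; have := lx (lab k) ltac:(lia); lia.
  have hkp : (level (lab k) <= level (prev_low level (lab x)))%R.
    case: (altP (lab k =P prev_low level (lab x))) => [<-//|ne].
    by apply/ltW/lk; lia.
  have -> : lab k < lab y by lia.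
  rewrite ltnNge; apply/negP => ny.
  case: (leqP (next_low m level (lab k)) (prev_low level (lab y))) => c;
    first lia.
  case: (altP (next_low m level (lab k) =P lab y)) => [e'|ne].
    by rewrite e' in hk; rewrite -e in hy; lia.
  by have := ly (next_low m level (lab k)) ltac:(lia); rewrite -e in hy; lia.
(* The laser from the larger previous lower index, that of y, covers y. It cannot cover x, for which
   it would start at a closer lower index. *)
have sep (x y : label b) : prev_low level (lab x) < prev_low level (lab y) ->
  ~~ Prel D x y.
  move=> lt; have yb := lab_bound y; have [py hy ly] := prev_lowP hE yb.
  have [px hx lx] := prev_lowP hE (lab_bound x).
  have [k kE] := @labP m (prev_low level (lab y)) ltac:(lia).
  have [/andP[kn nb] hn hl] := next_lowP hE (lab_bound k).
  have kb := lab_bound k.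
  have [l lE] := @labP m (next_low m level (lab k)).-1 ltac:(lia).
  have kl : (k, l) \in lasers D.
    rewrite in_lasers lE (ltn_predK kn) eqxx andbT lt0n; apply/eqP => v0.
    have := prev_low_step hE yb; rewrite -kE levelS v0 muln0; lia.
  apply/negP => /forallP /(_ (k, l)) /implyP /(_ kl) /eqP.
  rewrite !aboveE // => e.
  have : lab k < lab y < next_low m level (lab k).
    have ky : lab k < lab y by rewrite kE.
    rewrite ky /= ltnNge; apply/negP => c.
    case: (altP (next_low m level (lab k) =P lab y)) => [e'|ne].
      by rewrite e' in hn; rewrite -kE in hy; lia.
    by have := ly (next_low m level (lab k)) ltac:(lia); rewrite -kE in hy; lia.
  rewrite -e => /andP[kx xn]; have := hl (lab x); rewrite kx xn => /(_ isT) hh.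
  by have := lx (lab k); rewrite kE in kx hh *; lia.
apply/idP/eqP => [e|e].
  case: (ltngtP (prev_low level (lab i)) (prev_low level (lab j))) => // c.
    by have := sep _ _ c; rewrite e.
  have := sep _ _ c; suff -> : Prel D j i by [].
  by apply/forallP => l; apply/implyP => lD; rewrite eq_sym;
    move/forallP/(_ l)/implyP: e; apply.
apply/forallP => -[k l]; apply/implyP => kl; rewrite !aboveE //.
by apply/eqP; apply/idP/idP; apply: prev_above.
Qed.

(** Every generator preserves the next lower index. Conversely each label is joined by its laser to
    the label just before its next lower index, a common root of the class. *)
Lemma connect_QgenP (i j : label b) :
  connect (Qgen D) i j = (next_low m level (lab i) == next_low m level (lab j)).
Proof.
have laser_next (x y : label b) : (x, y) \in lasers D ->
    next_low m level (lab y) = next_low m level (lab x).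
  rewrite in_lasers => /andP[_ /eqP e].
  by have := next_low_pred hE (lab_bound x); rewrite e.
apply/idP/eqP => [/connectP[p pp ->]|e].
  elim: p i pp => //= x p IH i /andP[ix /IH <-].
  case/or3P: ix => [/existsP[k /and3P[_ /laser_next <- /laser_next <-]]//
    |/laser_next ->//|/laser_next ->//].
have root (x : label b) : exists2 y : label b, (lab y).+1 =
  next_low m level (lab x)
    & connect (Qgen D) x y /\ connect (Qgen D) y x.
  have xb := lab_bound x; have [xn _ _] := next_lowP hE xb.
  have [y yE] := @labP m (next_low m level (lab x)).-1 ltac:(lia).
  exists y; first by rewrite yE; lia.
  (* With an empty run there is no laser, but the level falls at once and x is its own root. *)
  case: (posnP (run D (lab x))) => [v0|v0].
    have -> : y = x; last by rewrite !connect0.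
    by have := run0_next xb v0; move: yE; rewrite /lab => yE e';
      apply: ord_inj; lia.
  have xy : (x, y) \in lasers D by rewrite in_lasers v0 yE; lia.
  by split; apply: connect1; rewrite /Qgen xy ?orbT.
have [x xE [ix _]] := root i; have [y yE [_ yj]] := root j.
have xy : x = y by apply: ord_inj; move: xE; rewrite e -yE /lab; lia.
by apply: connect_trans ix _; rewrite xy.
Qed.

Lemma vertex_block_PQ (B : tblock b) :
  (exists2 i : 'I_b, true & vertex_block m level i = B) <->
  match B with inl B => B \in Pblocks D | inr B => B \in Qblocks D end.
Proof.
have blockE R (f : nat -> nat) (B' : {set label b}) :
    (forall i j, R i j = (f (lab i) == f (lab j))) ->
    reflect (exists k : label b, B' = [set j | f (lab j) == f (lab k)])
      (B' \in equivalence_partition R [set: label b]).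
  move=> Rf; apply: (iffP imsetP) => [[k _ ->]|[k ->]]; exists k => //.
    by apply/setP => j; rewrite !inE Rf eq_sym.
  by apply/setP => j; rewrite !inE Rf eq_sym.
split=> [[i _ <-]|].
  have ib := ltn_ord i; have [[k ki _]|[k ki _]] := vertex_blockP hE ib.
    rewrite -ki prev_block //; apply/(blockE _ _ _ PrelP); by exists k.
  have -> : val i = (next_low m level (lab k)).-1 by rewrite ki.
  by rewrite next_block //; apply/(blockE _ _ _ connect_QgenP); exists k.
case: B => B /=.
  move=> /(blockE _ _ _ PrelP) [k ->].
  have kb := lab_bound k; have [pk _ _] := prev_lowP hE kb.
  have pb : prev_low level (lab k) < b by lia.
  by exists (Ordinal pb) => //=; rewrite prev_block.
move=> /(blockE _ _ _ connect_QgenP) [k ->].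
have kb := lab_bound k; have [pk _ _] := next_lowP hE kb.
have pb : (next_low m level (lab k)).-1 < b by lia.
by exists (Ordinal pb) => //=; rewrite next_block.
Qed.

Lemma pair_of_pathE (B : tblock b) : pair_of_path D B =
  if [pick i : 'I_b | vertex_block m level i == B] is Some i
  then Some (run D i) else None.
Proof.
have := vertex_block_PQ B; case: pickP => [i /eqP iB|none] H.
  have idx := vertex_blockK hE (ltn_ord i).
  have : exists2 i : 'I_b, true & vertex_block m level i = B by exists i.
  rewrite ffunE; rewrite iB in idx; move/H.
  by case: B idx {H iB} => B /= idx ->; rewrite -idx.
have {}H : ~ match B with inl B => B \in Pblocks D | inr B =>
  B \in Qblocks D end.
  by move/H => [i _ iB]; have := none i; rewrite iB eqxx.
by rewrite ffunE; case: B H {none} => B /= /negP/negbTE ->.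
Qed.
End PathBlocks.

(** * Noncrossing parking functions as functions *)

Section Families.
Variables (a m : nat).
Local Notation b := m.+2.
Implicit Types (beta : 'I_b -> tblock b) (psi : {ffun 'I_a -> 'I_b}).

Definition block_family beta psi : family_on b {set 'I_a} :=
  [ffun B => if [pick i | beta i == B] is Some i
             then Some [set y | psi y == i] else None].

Lemma block_familyE beta psi i : injective beta ->
  block_family beta psi (beta i) = Some [set y | psi y == i].
Proof.
move=> betaI; rewrite ffunE; case: pickP => [j /eqP/betaI ->//|/(_ i)].
by rewrite eqxx.
Qed.

Lemma block_familyN beta psi B : (forall i, beta i <> B) ->
  block_family beta psi B = None.
Proof. by move=> nB; rewrite ffunE; case: pickP => // i /eqP /nB. Qed.

Lemma block_family_support beta psi B :
  block_family beta psi B -> exists i, beta i = B.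
Proof. by rewrite ffunE; case: pickP => // i /eqP <- _; exists i. Qed.

Lemma block_family_comp beta (tau : 'I_b -> 'I_b) psi :
  injective beta -> injective tau ->
  block_family (beta \o tau) psi = block_family beta [ffun y => tau (psi y)].
Proof.
move=> betaI tauI; apply/ffunP => B; have [g tauK gK] := injF_bij tauI.
case: (pickP (fun i => beta i == B)) => [j /eqP <-|none].
  rewrite block_familyE // -{1}[j]gK.
  rewrite -[beta (tau (g j))]/((beta \o tau) (g j)) block_familyE; last first.
    exact: inj_comp.
  by congr Some; apply/setP => y; rewrite !inE ffunE -{2}[j]gK (inj_eq tauI).
rewrite !block_familyN // => i /eqP; first by rewrite none.
by rewrite /= none.
Qed.

(** The family determines psi although the blocks are not given in advance, because [idx] reads the
    run off the block. *)
Lemma block_family_inj (idx : tblock b -> nat) beta beta' psi psi' :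
  (forall i, idx (beta i) = i) -> (forall i, idx (beta' i) = i) ->
  block_family beta psi = block_family beta' psi' -> psi = psi'.
Proof.
move=> idxK idxK' e; apply/ffunP => y.
have betaI : injective beta.
  by move=> i j ij; apply: val_inj; rewrite /= -idxK ij idxK.
have betaI' : injective beta'.
  by move=> i j ij; apply: val_inj; rewrite /= -idxK' ij idxK'.
have := congr1 (fun F : family_on b {set 'I_a} => F (beta (psi y))) e.
rewrite block_familyE //; case: (pickP (fun i => beta' i == beta (psi y))).
  move=> i /eqP iB; rewrite -iB block_familyE // => -[] /setP /(_ y).
  rewrite !inE eqxx => /esym /eqP ->; apply: val_inj.
  by rewrite /= -idxK -iB idxK'.
by move=> none; rewrite (@block_familyN beta') // => i /eqP; rewrite none.
Qed.

Lemma rot_blockK k : cancel (@rot_block b k) (rot_block (- k)%R).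
Proof.
by move=> B; have := rot_blockD k (- k)%R B; rewrite opprK subrr rot_block0.
Qed.

Lemma rot_blockVK k : cancel (@rot_block b (- k)%R) (rot_block k).
Proof. by move=> B; rewrite -{1}[k]opprK rot_blockK. Qed.

Lemma rot_block_family k beta psi :
  rot_family k (block_family beta psi) = block_family (rot_block k \o beta) psi.
Proof.
apply/ffunP => B; rewrite !ffunE; congr (if _ is Some _ then _ else _).
by apply: eq_pick => i /=; rewrite -[RHS](can_eq (rot_blockVK k)) rot_blockK.
Qed.

Definition relabel (w : 'S_a) psi : {ffun 'I_a -> 'I_b} :=
  [ffun y => psi ((w^-1)%g y)].

Lemma perm_block_family w beta psi :
  perm_family w (block_family beta psi) = block_family beta (relabel w psi).
Proof.
apply/ffunP => B; rewrite !ffunE; case: pickP => //= i _; congr Some.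
apply/setP => y; rewrite inE ffunE; apply/imsetP/eqP => [[x]|yi].
  by rewrite inE => /eqP <- ->; rewrite permK.
by exists ((w^-1)%g y); rewrite ?permKV // inE yi.
Qed.

Lemma rot_family0 (T : finType) (f : family_on b T) : rot_family 0%R f = f.
Proof. by apply/ffunP => B; rewrite ffunE rot_block0. Qed.

Lemma rot_familyD (T : finType) k l (f : family_on b T) :
  rot_family (k + l)%R f = rot_family k (rot_family l f).
Proof. by apply/ffunP => B; rewrite !ffunE addrC rot_blockD. Qed.

Lemma rot_perm_family w k (f : family_on b {set 'I_a}) :
  rot_family k (perm_family w f) = perm_family w (rot_family k f).
Proof. by apply/ffunP => B; rewrite !ffunE. Qed.

Lemma perm_familyK (w : 'S_a) :
  cancel (@perm_family a b w) (@perm_family a b w^-1).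
Proof.
move=> f; apply/ffunP => B; rewrite !ffunE; case: (f B) => //= X; congr Some.
rewrite -imset_comp -[RHS]imset_id; apply: eq_imset => y /=.
by rewrite permK.
Qed.
End Families.

(** * Parking functions and the decorated pairs that they encode *)

Section Parking.
Variables (a m : nat).
Local Notation b := m.+2.
Local Notation n := m.+1.
Implicit Types (psi : {ffun 'I_a -> 'I_b}) (i : 'I_b).

Definition fiber psi (i : nat) : nat := #|[set y | psi y == i :> nat]|.

Definition path_of psi : b.-tuple 'I_a.+1 :=
  [tuple inord (fiber psi i) | i < b].

Definition plevel psi : nat -> int := level (path_of psi).

Definition parking : {set {ffun 'I_a -> 'I_b}} :=
  [set psi | is_dyck (path_of psi)].

Definition path_block psi (i : 'I_b) : tblock b :=
  vertex_block m (plevel psi) i.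

Definition path_family psi : family_on b {set 'I_a} :=
  block_family (path_block psi) psi.

Lemma run_path_of psi (i : nat) : i < b ->
  run (path_of psi) i = fiber psi i :> nat.
Proof.
move=> ib; rewrite /run -(tnth_nth _ _ (Ordinal ib)) tnth_mktuple inordK //.
by rewrite ltnS -[X in _ <= X]card_ord max_card.
Qed.

Lemma height_path_of psi : height (path_of psi) b = a.
Proof.
rewrite /height big_mkord.
have : \sum_(i < b) #|[set y | psi y == i]| = a.
  rewrite -[RHS]card_ord -sum1_card (partition_big psi xpredT) //=.
  by apply: eq_bigr => i _; rewrite sum1dep_card.
move=> e; rewrite -[RHS]e; apply: eq_bigr => i _; rewrite run_path_of //.
Qed.

Lemma plevelS psi (i : nat) : i < b ->
  (plevel psi i.+1 = plevel psi i + (b * fiber psi i)%:Z - a%:Z)%R.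
Proof. by move=> ib; rewrite /plevel levelS run_path_of. Qed.

Lemma plevel0 psi : plevel psi 0 = 0%R.
Proof. by rewrite /plevel /level /height big_geq // !muln0. Qed.

Lemma plevelb psi : plevel psi b = 0%R.
Proof. by rewrite /plevel /level height_path_of mulnC subrr. Qed.

Hypotheses (a_gt0 : 0 < a) (co_ab : coprime a b).

Lemma parkingP psi :
  reflect (forall i : nat, 0 < i < b -> (0 < plevel psi i)%R) (psi \in parking).
Proof.
rewrite inE; apply: (iffP idP) => [dyck i|pos].
  by apply: exc_gt0; apply: path_excursion.
rewrite /is_dyck height_path_of eqxx /=; apply/forallP => -[i /= ib].
case: (posnP i) => [->|i0]; first by rewrite muln0.
have : (0 <= plevel psi i)%R.
  case: (altP (i =P b)) => [->|ne]; first by rewrite plevelb.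
  by apply: ltW; apply: pos; lia.
by rewrite /plevel /level; lia.
Qed.

Lemma parking_excursion psi : psi \in parking -> excursion m (plevel psi).
Proof. by rewrite inE => ?; apply: path_excursion. Qed.

Lemma path_blockK psi i : psi \in parking -> block_index (path_block psi i) = i.
Proof. by move=> /parking_excursion hE; apply: vertex_blockK. Qed.

Lemma path_block_inj psi : psi \in parking -> injective (path_block psi).
Proof. by move=> pK i j e; apply: val_inj;
  rewrite /= -(path_blockK i pK) e path_blockK. Qed.

Lemma path_family_inj : {in parking &, injective path_family}.
Proof.
move=> psi psi' pK pK'; apply: (@block_family_inj _ _ (@block_index m)) => i;
exact: path_blockK.
Qed.

Definition park psi : ranked_pair a b * family_on b {set 'I_a} :=
  (pair_of_path (path_of psi), path_family psi).

Lemma park_pair psi B : psi \in parking ->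
  omap val ((park psi).1 B) = omap (fun X : {set 'I_a} =>
    #|X|) ((park psi).2 B).
Proof.
rewrite inE => pK; rewrite /park /= pair_of_pathE // ffunE.
by case: pickP => //= i _; rewrite run_path_of.
Qed.

(** From (P, Q) = pi(D) and f, send y to the run of the block whose set contains y. The rank
    condition says that the fibers have the sizes of the runs of D, so the path of this function is
    D. *)
Lemma ParkNCP x : reflect (exists2 psi, psi \in parking & x =
  park psi) (x \in ParkNC a b).
Proof.
case: x => PQ f; rewrite inE; apply: (iffP and4P) => [[PQ_NC /forallP fcard
  fdis fcov]|]; last first.
  case=> psi pK [-> ->]; have pI := path_block_inj pK; split.
  - by apply/imsetP; exists (path_of psi) => //; move: pK; rewrite !inE.
  - by apply/forallP => B; rewrite -park_pair.
  - apply/forallP => B; apply/forallP => C; apply/implyP => BC.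
    rewrite /path_family !ffunE; case: pickP => [i /eqP iB|_] /=;
      last by rewrite disjoints_subset sub0set.
    case: pickP => [j /eqP jC|_] /=; last by rewrite disjoint_sym
      disjoints_subset sub0set.
    rewrite disjoints_subset; apply/subsetP => y; rewrite !inE => /eqP yi.
    by apply: contra BC => /eqP yj; rewrite -iB -jC -yi -yj.
  apply/eqP/setP => y; rewrite inE; apply/bigcupP.
  by exists (path_block psi (psi y)) => //; rewrite block_familyE // inE.
have [D dyckD DE] := imsetP PQ_NC; rewrite inE in dyckD.
pose S B := odflt set0 (f B).
pose blk (i : 'I_b) := vertex_block m (level D) i.
have hE := path_excursion a_gt0 co_ab dyckD.
have blkI : injective blk by move=> i j /(vertex_block_inj hE) e;
  apply: val_inj; apply: e.
have fcardE B : omap (fun X : {set 'I_a} => #|X|) (f B) = omap val (PQ B)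
  by apply/eqP.
have SE i : f (blk i) = Some (S (blk i)) /\ #|S (blk i)| = run D i.
  have := fcardE (blk i); rewrite DE pair_of_pathE //.
  case: pickP => [j /eqP /blkI ->|/(_ i)]; last by rewrite eqxx.
  by rewrite /S; case: (f (blk i)) => //= X [->].
have SN B : (forall i, blk i <> B) -> f B = None.
  move=> nB; have := fcardE B; rewrite DE pair_of_pathE //.
  by case: pickP => [j /eqP /nB //|_]; case: (f B).
have cov y : exists i, y \in S (blk i).
  have := in_setT y; rewrite -(eqP fcov) => /bigcupP[B _ yB].
  case: (pickP (fun i => blk i == B)) => [i /eqP iB|none]; first by exists i;
    rewrite /S iB.
  by rewrite SN // in yB => [|i /eqP]; [rewrite inE in yB|rewrite none].
(* The default [ord0] is never taken, since the sets cover [a]. *)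
pose psi := [ffun y => odflt ord0 [pick i | y \in S (blk i)]].
have psiS y i : (y \in S (blk i)) = (psi y == i).
  rewrite ffunE; case: pickP => [j yj|none]; last by have [j] := cov y;
    rewrite none.
  apply/idP/eqP => [yi|<- //] /=; apply/eqP; apply/negPn/negP => ne.
  move/forallP/(_ (blk j))/forallP/(_ (blk i))/implyP: fdis.
  rewrite (inj_eq blkI) => /(_ ne);
    rewrite disjoints_subset => /subsetP /(_ y yj).
  by rewrite inE -/(S _) yi.
have fiberE i : fiber psi i = run D i.
  by have [_ <-] := SE i; apply: eq_card => y; rewrite inE psiS.
have pathE : path_of psi = D.
  apply: eq_from_tnth => i; rewrite !(tnth_nth ord0) -/(run _ i) -/(run D i).
  by apply: val_inj; rewrite /= run_path_of.
exists psi; first by rewrite inE pathE.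
rewrite /park pathE -DE; congr (_, _); apply/ffunP => B.
have path_blockE : path_block psi = blk by rewrite /path_block /plevel pathE.
rewrite /path_family path_blockE;
  case: (pickP (fun i => blk i == B)) => [i /eqP <-|none].
  by rewrite block_familyE //; have [-> _] := SE i; congr Some;
    apply/setP => y; rewrite inE psiS.
by rewrite SN ?block_familyN // => i /eqP; rewrite none.
Qed.

Definition park_fixed (w : 'S_a) (k : label b) : {set {ffun 'I_a -> 'I_b}} :=
  [set psi in parking | perm_family w (rot_family k (path_family psi)) ==
    path_family psi].

(** Ranks are the cardinalities of the sets, so fixing the decoration already fixes the ranked
    pair. *)
Lemma park_fixedE psi w k : psi \in parking ->
  (park_act (park psi) (w, k) == park psi) =
  (perm_family w (rot_family k (path_family psi)) == path_family psi).
Proof.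
move=> pK; apply/eqP/eqP => [[]//|e]; rewrite /park_act /= e; congr (_, _).
apply/ffunP => B; rewrite ffunE.
have eB : path_family psi B = omap (fun X : {set 'I_a} => w @: X)
    (path_family psi (rot_block (- k)%R B)).
  by rewrite -{1}e; do 2 rewrite ffunE.
have := park_pair (rot_block (- k)%R B) pK; have := park_pair B pK;
  rewrite /= eB.
move: (rot_block _ B) => B'.
move: (path_family psi B') (pair_of_path _ B) (pair_of_path _ B') =>
  [X|] [r|] [s|] //=.
rewrite card_imset; last exact: perm_inj.
by move=> [rX] [sX]; congr Some; apply: val_inj; rewrite /= rX sX.
Qed.

Lemma perm_char_park (F : fieldType) w k :
  perm_char F (park_action a b) (ParkNC a b) (w, k) = (#|park_fixed w k|%:R)%R.
Proof.
rewrite /perm_char /mxtrace; under eq_bigr do rewrite mxE.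
rewrite -(big_enum_val (fun x => (park_action a b x (w, k) == x)%:R%R)) /=.
have -> : ParkNC a b = park @: parking.
  by apply/setP => x; apply/ParkNCP/imsetP => -[psi pK ->]; exists psi.
rewrite big_imset /=;
  last by move=> psi psi' pK pK' [_ /(path_family_inj pK pK')].
under eq_bigr => psi pK do rewrite park_fixedE //.
rewrite -natr_sum -sum1_card; congr (_%:R)%R.
rewrite big_mkcond [RHS]big_mkcond; apply: eq_bigr => psi _.
rewrite [psi \in park_fixed _ _]inE.
by case: (psi \in parking) => //=; case: eqP.
Qed.
End Parking.

(** * Rotation of parking functions *)

Section Moves.
Variables (a m : nat).
Local Notation b := m.+2.
Local Notation n := m.+1.
Implicit Types (psi : {ffun 'I_a -> 'I_b}) (i : 'I_b) (k s t : label b).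

Definition move_index (tau : 'I_b -> 'I_b) psi : {ffun 'I_a -> 'I_b} :=
  [ffun y => tau (psi y)].

Lemma fiber_move (tau : 'I_b -> 'I_b) psi i : injective tau ->
  fiber (move_index tau psi) (tau i) = fiber psi i.
Proof.
by move=> tauI; apply: eq_card => y; rewrite !inE ffunE !val_eqE (inj_eq tauI).
Qed.

Lemma plevel_move (tau : 'I_b -> 'I_b) (taun : nat -> nat) psi :
  injective tau -> (forall i, tau i = taun i :> nat) ->
  forall j, j < b -> (plevel (move_index tau psi) (taun j).+1 -
     plevel (move_index tau psi) (taun j) = plevel psi j.+1 - plevel psi j)%R.
Proof.
move=> tauI tauE j jb; rewrite -(tauE (Ordinal jb)) !plevelS //.
by rewrite fiber_move //=; lia.
Qed.

(* Fixes c and shifts the other indices cyclically. *)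
Definition cshift (c : 'I_b) t i : 'I_b :=
  if unlift c i is Some j then lift c (j + t)%R else c.

Lemma cshift_center c t : cshift c t c = c.
Proof. by rewrite /cshift unlift_none. Qed.

Lemma cshift_lift c t (j : 'I_n) : cshift c t (lift c j) = lift c (j + t)%R.
Proof. by rewrite /cshift liftK. Qed.

Lemma cshiftD c s t i : cshift c (s + t)%R i = cshift c s (cshift c t i).
Proof.
case: (unliftP c i) => [j ->|->]; last by rewrite !cshift_center.
by rewrite !cshift_lift addrAC addrA.
Qed.

Lemma cshift0 c i : cshift c 0%R i = i.
Proof. by case: (unliftP c i) => [j ->|->];
  rewrite ?cshift_center // cshift_lift addr0. Qed.

Lemma cshift_inj c t : injective (cshift c t).
Proof.
by apply: (can_inj (g := cshift c (- t)%R)) => i;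
  rewrite -cshiftD addNr cshift0.
Qed.

(** Rewrites addition of t modulo n as a cut at -t, the form in which the shifted levels were
    computed; x is counted from 1. *)
Lemma val_shift (t : 'I_n) x : 0 < x <= n ->
  ((x.-1 + t) %% n).+1 =
  if x <= (- t)%R then x + n - (- t)%R else x - (- t)%R.
Proof.
move=> xn; have tn := ltn_ord t; rewrite /=.
case: (posnP t) => [->|t0].
  by rewrite subn0 modnn addn0 modn_small; case: leqP; lia.
rewrite (@modn_small (n - t)); last lia.
case: leqP => c; first by rewrite modn_small; lia.
by rewrite (_ : x.-1 + t = x - (n - t) - 1 + n) ?modnDr ?modn_small; lia.
Qed.

Definition cshift_first_nat (r i : nat) : nat :=
  if i == 0 then 0 else if i <= r then i + n - r else i - r.

Definition cshift_last_nat (r i : nat) : nat :=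
  if i == n then n else if i < r then i + n - r else i - r.

Lemma val_cshift_first t i : cshift ord0 t i =
  cshift_first_nat (- t)%R i :> nat.
Proof.
case: (unliftP ord0 i) => [j ->|->]; last by rewrite cshift_center.
rewrite /cshift_first_nat cshift_lift -val_shift;
  last by rewrite lift0 /= (ltn_ord j).
by rewrite !lift0.
Qed.

Lemma val_cshift_last t i : cshift ord_max t i =
  cshift_last_nat (- t)%R i :> nat.
Proof.
rewrite /cshift_last_nat.
case: (unliftP ord_max i) => [j' ->|->]; last by rewrite cshift_center /= eqxx.
pose j : 'I_n := j'; rewrite -[j']/j.
rewrite cshift_lift !lift_max; have jn := ltn_ord j.
have := @val_shift t j.+1 ltac:(lia); rewrite /= => e.
have -> : (j == n :> nat) = false by lia.
have : (n - t) %% n < n by rewrite ltn_mod.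
by move: e; case: leqP; lia.
Qed.

Lemma lab_add k t : lab (k + t)%R =
  if lab k <= (- t)%R then lab k + n - (- t)%R else lab k - (- t)%R.
Proof. by rewrite -val_shift //; have := lab_bound k; lia. Qed.

Hypotheses (a_gt0 : 0 < a) (co_ab : coprime a b).

Lemma path_block_move (tau : 'I_b -> 'I_b) (taun : nat -> nat) t psi :
  injective tau -> (forall i, tau i = taun i :> nat) ->
  psi \in parking a m -> move_index tau psi \in parking a m ->
  (forall k, prev_low (plevel (move_index tau psi)) (lab (k + t)%R) =
     taun (prev_low (plevel psi) (lab k))) ->
  (forall k, next_low m (plevel (move_index tau psi)) (lab (k + t)%R) =
     (taun (next_low m (plevel psi) (lab k)).-1).+1) ->
  forall i, path_block (move_index tau psi) (tau i) =
    rot_block t (path_block psi i).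
Proof.
move=> tauI tauE pK pK' hp hn i; rewrite /path_block tauE.
apply: vertex_block_transfer => //; try exact: parking_excursion.
- move=> j j' jb jb'; rewrite -(tauE (Ordinal jb)) -(tauE (Ordinal jb')).
  by move/ord_inj/tauI => -[].
- exact: plevel_move.
Qed.

Lemma path_family_move (tau : 'I_b -> 'I_b) t psi :
  injective tau -> psi \in parking a m -> move_index tau psi \in parking a m ->
  (forall i, path_block (move_index tau psi) (tau i) =
    rot_block t (path_block psi i)) ->
  path_family (move_index tau psi) = rot_family t (path_family psi).
Proof.
move=> tauI pK pK' e;
  rewrite /path_family rot_block_family -block_family_comp //.
  by apply/ffunP => B; rewrite !ffunE; congr (if _ is Some _ then _ else _);
    apply: eq_pick => i /=; rewrite e.
exact: path_block_inj.
Qed.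

Lemma path_family_rot1 psi : psi \in parking a m ->
  exists2 psi', psi' \in parking a m &
  path_family psi' = rot_family (rot_gen b) (path_family psi).
Proof.
move=> pK; have hE := parking_excursion a_gt0 co_ab pK.
set p := prev_low (plevel psi) n.
have [pn _ _] := @prev_lowP _ _ hE n ltac:(lia).
pose taun (i : nat) := if i == p then 0 else if i == n then p.+1 else i.+1.
have taunb (i : nat) : taun i < b \/ b <= i by rewrite /taun; case: ifP => ?;
  [|case: ifP => ?]; lia.
pose tau (i : 'I_b) : 'I_b := inord (taun i).
have tauE i : tau i = taun i :> nat.
  by rewrite inordK //; have := taunb i; have := ltn_ord i; lia.
have tauI : injective tau.
  move=> i j /(congr1 val) /=; rewrite !tauE => e; apply: ord_inj; move: e.
  have := ltn_ord i; have := ltn_ord j.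
  by rewrite /taun; repeat (case: ifP => ?); lia.
have steps := plevel_move psi tauI tauE.
have gt0 := rotate_gt0 (plevel0 psi) (plevelb psi) (plevel0 _) hE
  (erefl p) steps.
have pK' : move_index tau psi \in parking a m by apply/parkingP.
have hE' := parking_excursion a_gt0 co_ab pK'.
have labE k : lab (k + rot_gen b)%R = if lab k == n then 1 else (lab k).+1.
  rewrite /lab /= modnDmr addn1.
  case: (altP (k.+1 =P n)) => [->|ne]; first by rewrite modnn.
  by rewrite modn_small // ltn_neqAle ne (ltn_ord k).
exists (move_index tau psi) => //; apply: path_family_move => // i.
apply: (path_block_move tauI tauE) => // k; rewrite labE.
  exact: (rotate_prev (plevel0 psi) (plevelb psi) (plevel0 _) hE (erefl p)
    steps hE' (lab_bound k)).
exact: (rotate_next (plevel0 psi) (plevelb psi) (plevel0 _) hE (erefl p) steps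
  hE' (lab_bound k)).
Qed.

Lemma path_family_rot t psi : psi \in parking a m ->
  exists2 psi', psi' \in parking a m &
  path_family psi' = rot_family t (path_family psi).
Proof.
have -> : t = (rot_gen b *+ t)%R.
  by apply: val_inj; rewrite Zp_mulrn /= modnMml mul1n modn_small.
elim: (nat_of_ord t) psi => [|r IH] psi pK; first by exists psi;
  rewrite ?mulr0n ?rot_family0.
have [psi' pK' e'] := IH _ pK; have [psi'' pK'' e''] := path_family_rot1 pK'.
by exists psi''; rewrite // e'' e' -rot_familyD mulrS.
Qed.

Lemma cshift_first_parking t psi :
  (forall k : nat, (- t)%R < k < b ->
     (0 < plevel psi k - plevel psi (lab (- t)%R) + plevel psi 1)%R) ->
  (forall k : nat, 0 < k <= (- t)%R ->
    (plevel psi (lab (- t)%R) < plevel psi k)%R) ->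
  move_index (cshift ord0 t) psi \in parking a m.
Proof.
move=> A B; apply/parkingP => //.
exact: (shift_prev_gt0 (plevel0 psi) (plevelb psi) (plevel0 _) (ltn_ord (- t)%R)
  (plevel_move psi (@cshift_inj _ _) (val_cshift_first t)) A B).
Qed.

Lemma cshift_last_parking t psi :
  (forall k : nat, (- t)%R < k < b -> (plevel psi (- t)%R < plevel psi k)%R) ->
  (forall k : nat, 0 < k <= (- t)%R ->
     (0 < plevel psi k + plevel psi n - plevel psi (- t)%R)%R) ->
  move_index (cshift ord_max t) psi \in parking a m.
Proof.
move=> A B; apply/parkingP => //.
exact: (shift_next_gt0 (plevel0 psi) (plevelb psi) (plevel0 _) (ltn_ord (- t)%R)
  (plevel_move psi (@cshift_inj _ _) (val_cshift_last t)) A B).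
Qed.

Lemma path_block_cshift_first t psi i : psi \in parking a m ->
  move_index (cshift ord0 t) psi \in parking a m ->
  path_block (move_index (cshift ord0 t) psi) (cshift ord0 t i) = rot_block t
    (path_block psi i).
Proof.
move=> pK pK'; have hE := parking_excursion a_gt0 co_ab pK.
have hE' := parking_excursion a_gt0 co_ab pK'.
have steps := plevel_move psi (@cshift_inj ord0 t) (val_cshift_first t).
apply: (path_block_move (@cshift_inj ord0 t) (val_cshift_first t)) => // k;
  rewrite lab_add.
  exact: (shift_prev_prev (plevel0 psi) (plevelb psi) (plevel0 _) (ltn_ord
    (- t)%R)
    steps hE hE' (lab_bound k)).
exact: (shift_prev_next (plevel0 psi) (plevelb psi) (plevel0 _) (ltn_ord
  (- t)%R)
  steps hE hE' (lab_bound k)).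
Qed.

Lemma path_block_cshift_last t psi i : psi \in parking a m ->
  move_index (cshift ord_max t) psi \in parking a m ->
  path_block (move_index (cshift ord_max t) psi) (cshift ord_max t i) =
    rot_block t (path_block psi i).
Proof.
move=> pK pK'; have hE := parking_excursion a_gt0 co_ab pK.
have hE' := parking_excursion a_gt0 co_ab pK'.
have steps := plevel_move psi (@cshift_inj ord_max t) (val_cshift_last t).
apply: (path_block_move (@cshift_inj ord_max t) (val_cshift_last t)) => // k;
  rewrite lab_add.
  exact: (shift_next_prev (plevel0 psi) (plevelb psi) (plevel0 _) (ltn_ord
    (- t)%R)
    steps hE hE' (lab_bound k)).
exact: (shift_next_next (plevel0 psi) (plevelb psi) (plevel0 _) (ltn_ord
  (- t)%R)
  steps hE hE' (lab_bound k)).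
Qed.
End Moves.

(** Serves where partners are only known to exist: a relation that is total on X and injective there
    gives the inequality. *)
Lemma leq_card_relation (T U : finType) (G : T -> U ->
  bool) (X : {set T}) (Y : {set U}) :
  (forall x, x \in X -> exists2 y, y \in Y & G x y) ->
  (forall x x' y, x \in X -> x' \in X -> G x y -> G x' y -> x = x') ->
    #|X| <= #|Y|.
Proof.
move=> ex inj.
case: (set_0Vmem X) => [->|[x0 x0X]]; first by rewrite cards0.
have [y0 _ _] := ex x0 x0X.
pose f x := odflt y0 [pick y in Y | G x y].
have fP x : x \in X -> (f x \in Y) && G x (f x).
  move=> /ex [y yY Gxy]; rewrite /f; case: pickP => [y' //|/(_ y)].
  by rewrite yY Gxy.
rewrite -(card_in_imset (f := f) (D := mem X)).
  by apply/subset_leq_card/subsetP => _ /imsetP[x /fP /andP[fY _] ->].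
by move=> x x' xX x'X e; apply: (inj x x' (f x)) => //;
  [case/andP: (fP x xX)|rewrite e; case/andP: (fP x' x'X)].
Qed.

(** * Fixed points with a center *)

Section Center.
Variables (a m : nat).
Local Notation b := m.+2.
Local Notation n := m.+1.
Hypotheses (a_gt0 : 0 < a) (co_ab : coprime a b).
Implicit Types (psi phi : {ffun 'I_a -> 'I_b}) (i : 'I_b) (k s t : label b).
Local Notation parking := (parking a m).

Definition block_set (B : tblock b) : {set label b} :=
  match B with inl B | inr B => B end.
Definition block_side (B : tblock b) : bool :=
  if B is inl _ then true else false.

Lemma block_set_rot k B : block_set (rot_block k B) = rot_set k (block_set B).
Proof. by case: B. Qed.

Lemma block_side_rot k B : block_side (rot_block k B) = block_side B.
Proof. by case: B. Qed.

Lemma rot_blockC k s (B : tblock b) :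
  rot_block k (rot_block s B) = rot_block s (rot_block k B).
Proof.
rewrite -[k]opprK -[s]opprK -!rot_blockD; congr rot_block.
by rewrite addrC.
Qed.

Lemma rot_block_add k s (B : tblock b) :
  rot_block (k + s)%R B = rot_block k (rot_block s B).
Proof. by rewrite -[k]opprK -[s]opprK -rot_blockD opprD. Qed.

Lemma relabel_path w psi : path_of (relabel w psi) = path_of psi.
Proof.
apply: eq_from_tnth => i; rewrite !tnth_mktuple; congr inord.
rewrite /fiber -[RHS](card_imset _ (@perm_inj _ w)); apply: eq_card => y.
rewrite inE ffunE; apply/eqP/imsetP => [yi|[x]].
  by exists ((w^-1)%g y); rewrite ?permKV // inE yi.
by rewrite inE => /eqP <- ->; rewrite permK.
Qed.

Lemma path_block_relabel w psi : path_block (relabel w psi) = path_block psi.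
Proof. by rewrite /path_block /plevel relabel_path. Qed.

Lemma path_family_relabel w psi :
  path_family (relabel w psi) = perm_family w (path_family psi).
Proof. by rewrite /path_family path_block_relabel perm_block_family. Qed.

Lemma relabel_parking w psi : (relabel w psi \in parking) = (psi \in parking).
Proof. by rewrite !inE relabel_path. Qed.

Lemma relabel_move w (tau : 'I_b -> 'I_b) psi :
  relabel w (move_index tau psi) = move_index tau (relabel w psi).
Proof. by apply/ffunP => y; rewrite !ffunE. Qed.

Lemma path_block_support k psi psi' i :
  psi \in parking -> psi' \in parking ->
  path_family psi' = rot_family k (path_family psi) ->
  exists j, path_block psi' j = rot_block k (path_block psi i).
Proof.
move=> pK pK' e; apply: (@block_family_support _ _ _ psi').
rewrite -/(path_family psi') e ffunE rot_blockK block_familyE //.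
exact: path_block_inj.
Qed.

Lemma path_block_neq0 psi i : psi \in parking -> exists k, k \in block_set
  (path_block psi i).
Proof.
move=> /(parking_excursion a_gt0 co_ab) hE; rewrite /path_block /vertex_block.
by case: (vertex_blockP hE (ltn_ord i)) => -[k ki [_ ->]]; exists k;
  rewrite inE ki.
Qed.

(** The interface of a center: run c of each parking function owns a block on the given side
    containing e, and shifting the other runs rotates the blocks. It is instantiated by the first
    run with label 1 in P, and by the last run with label n in Q. *)
Variables (c : 'I_b) (e : label b) (side : bool) (good : pred {ffun 'I_a ->
  'I_b}).
Local Notation shc t := (move_index (cshift c t)).

Hypothesis center_side : forall psi, psi \in parking ->
  (block_side (path_block psi c) == side) &&
    (e \in block_set (path_block psi c)).
Hypothesis center_uniq : forall psi i, psi \in parking ->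
  block_side (path_block psi i) = side ->
    e \in block_set (path_block psi i) -> i = c.
Hypothesis center_shift : forall psi k, psi \in parking ->
  k \in block_set (path_block psi c) -> shc (e - k)%R psi \in parking.
Hypothesis shift_block : forall t psi i, psi \in parking ->
  shc t psi \in parking ->
  path_block (shc t psi) (cshift c t i) = rot_block t (path_block psi i).
Hypothesis good_parking : forall psi, psi \in parking -> good psi.
Hypothesis good_shift : forall t psi, good (shc t psi) = good psi.
Hypothesis good_exists : forall psi, good psi ->
  exists t, shc t psi \in parking.

Lemma shift_family t psi : psi \in parking -> shc t psi \in parking ->
  path_family (shc t psi) = rot_family t (path_family psi).
Proof.
move=> pK pK'; apply: path_family_move => // [|i]; first exact: cshift_inj.
exact: shift_block.
Qed.

Lemma shiftD s t psi : shc (s + t)%R psi = shc s (shc t psi).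
Proof. by apply/ffunP => y; rewrite !ffunE cshiftD. Qed.

Lemma shift0 psi : shc 0%R psi = psi.
Proof. by apply/ffunP => y; rewrite !ffunE cshift0. Qed.

Variables (w : 'S_a) (s : label b).
Hypothesis s_neq0 : s != 0%R.

Definition centered_fixed : {set {ffun 'I_a -> 'I_b}} :=
  [set psi in @park_fixed a m w s | [exists i, (block_side
    (path_block psi i) == side)
     && (rot_block s (path_block psi i) == path_block psi i)]].

Definition equivariant : {set {ffun 'I_a -> 'I_b}} :=
  [set phi | good phi && (relabel w (shc s phi) == phi)].

(* phi lives on Z_n and the center c; it is related to psi when some shift of
   phi is a parking function that rotates to psi. *)
Let G phi psi := [exists t, (shc t phi \in parking) &&
  (path_family psi == rot_family (- t)%R (path_family (shc t phi)))].

Lemma equivariant_shift phi t : relabel w (shc s phi) = phi ->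
  relabel w (shc s (shc t phi)) = shc t phi.
Proof. by move=> ephi; rewrite -shiftD addrC shiftD relabel_move ephi. Qed.

(** The shift by s keeps c and rotates blocks, while relabelling by w does not change the blocks. *)
Lemma equivariant_parking phi : phi \in parking ->
  relabel w (shc s phi) = phi ->
  rot_block s (path_block phi c) = path_block phi c /\
  perm_family w (rot_family s (path_family phi)) = path_family phi.
Proof.
move=> pK ephi; have pK' : shc s phi \in parking
  by rewrite -(relabel_parking w) ephi.
split; last by rewrite -shift_family // -path_family_relabel ephi.
by rewrite -shift_block // cshift_center -(path_block_relabel w) ephi.
Qed.

Lemma equivariant_center phi t psi : phi \in equivariant -> psi \in parking ->
  shc t phi \in parking ->
  path_family psi = rot_family (- t)%R (path_family (shc t phi)) ->
  exists i, path_block psi i = rot_block (- t)%R (path_block (shc t phi) c) /\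
   rot_block s (path_block psi i) = path_block psi i.
Proof.
rewrite inE => /andP[_ /eqP ephi] pK tK psiE.
have [rc _] := equivariant_parking tK (equivariant_shift t ephi).
have [i iE] := path_block_support c tK pK psiE.
by exists i; split=> //; rewrite iE rot_blockC rc.
Qed.

(** The relation [G] is shown total and injective in both directions, which gives the two
    inequalities. *)
Lemma card_centered_fixed : #|centered_fixed| = #|equivariant|.
Proof.
have G_total phi : phi \in equivariant ->
  exists2 psi, psi \in centered_fixed & G phi psi.
  move=> phiY; have := phiY; rewrite inE => /andP[gphi /eqP ephi].
  have [t tK] := good_exists gphi.
  have [psi pK psiE] := path_family_rot a_gt0 co_ab (- t)%R tK.
  exists psi; last by apply/existsP; exists t; rewrite tK psiE eqxx.
  have [i [iE ifix]] := equivariant_center phiY pK tK psiE.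
  have [_ fixt] := equivariant_parking tK (equivariant_shift t ephi).
  rewrite inE inE pK psiE -rot_familyD addrC rot_familyD -rot_perm_family
    fixt eqxx /=.
  apply/existsP; exists i; rewrite ifix eqxx andbT iE block_side_rot.
  by have /andP[] := center_side tK.
have G_inj phi phi' psi : phi \in equivariant -> phi' \in equivariant ->
    psi \in parking -> G phi psi -> G phi' psi -> phi = phi'.
  move=> phiY phiY' pK /existsP[t /andP[tK /eqP psiE]] /existsP[t' /andP[tK'
    /eqP psiE']].
  have [i [iE ifix]] := equivariant_center phiY pK tK psiE.
  have [i' [iE' ifix']] := equivariant_center phiY' pK tK' psiE'.
  (* Both are invariant blocks of psi, and there is at most one. *)
  have ii' : i = i'.
    apply: ord_inj; apply: (rot_fixed_unique
      (parking_excursion a_gt0 co_ab pK) s_neq0) => //.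
  rewrite -ii' {}iE in iE'.
  have blockE : path_block (shc t' phi') c =
    rot_block (t' - t)%R (path_block (shc t phi) c).
    by rewrite rot_block_add iE' rot_blockVK.
  have /andP[_] := center_side tK';
    rewrite blockE block_set_rot mem_rot_set => eC.
  have := center_shift tK eC; rewrite subKr => rK.
  (* The center of [shc t phi] contains e - (t' - t), so shifting by t' - t yields a parking
     function. It has the same family as [shc t' phi']. *)
  have eqt : shc (t' - t)%R (shc t phi) = shc t' phi'.
    apply: (path_family_inj a_gt0 co_ab) => //.
    rewrite shift_family // rot_familyD -psiE psiE' -rot_familyD subrr
      rot_family0 //.
  have := congr1 (shc (- t')%R) eqt.
  by rewrite -!shiftD !addrA addNr add0r addNr !shift0.
have G_fun phi psi psi' : psi \in parking -> psi' \in parking ->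
    G phi psi -> G phi psi' -> psi = psi'.
  move=> pK pK' /existsP[t /andP[tK /eqP psiE]] /existsP[t' /andP[tK' /eqP
    psiE']].
  apply: (path_family_inj a_gt0 co_ab) => //; rewrite psiE psiE'.
  have tt' : shc t' phi = shc (t' - t)%R (shc t phi) by rewrite -shiftD subrK.
  by rewrite tt' (shift_family tK) -?tt' // -rot_familyD addrA addNr add0r.
have G_onto psi : psi \in centered_fixed ->
  exists2 phi, phi \in equivariant & G phi psi.
  rewrite inE inE => /andP[/andP[pK /eqP psifix] /existsP[i /andP[/eqP iside
    /eqP ifix]]].
  have [k kC] := path_block_neq0 i pK.
  (* Rotating by e - k brings a label k of the invariant block to e, so [center_uniq] will place
     that block at index c. *)
  have [psi0 pK0 psi0E] := path_family_rot a_gt0 co_ab (e - k)%R pK.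
  have [j jE] := path_block_support i pK pK0 psi0E.
  have jc : j = c.
    apply: (center_uniq pK0); rewrite jE ?block_side_rot //.
    by rewrite block_set_rot mem_rot_set subKr.
  have es : (e - s)%R \in block_set (path_block psi0 c).
    (* Invariance under s puts e - s in the center along with e; this lets [center_shift] apply with
       shift s. *)
    rewrite -mem_rot_set -block_set_rot -jc jE rot_blockC ifix.
    by rewrite block_set_rot mem_rot_set subKr.
  have := center_shift pK0 es; rewrite subKr => sK.
  have eqv : relabel w (shc s psi0) = psi0.
    apply: (path_family_inj a_gt0 co_ab); rewrite ?relabel_parking //.
    rewrite path_family_relabel shift_family // psi0E.
    by rewrite -rot_familyD [(s + _)%R]addrC (rot_familyD (e - k)%R s)
      -rot_perm_family psifix.
  exists (shc (- (e - k))%R psi0).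
    by rewrite inE good_shift good_parking //= equivariant_shift.
  apply/existsP; exists (e - k)%R; rewrite -shiftD subrr shift0 pK0 psi0E.
  by rewrite -rot_familyD addNr rot_family0 eqxx.
have fixK psi : psi \in centered_fixed -> psi \in parking.
  by rewrite inE inE => /andP[/andP[]].
apply/eqP; rewrite eqn_leq; apply/andP; split.
  apply: (@leq_card_relation _ _ (fun psi phi => G phi psi)) => // psi psi' phi
    /fixK pK /fixK pK'.
  exact: G_fun.
apply: (@leq_card_relation _ _ (fun phi psi => G phi psi && (psi \in parking))).
  by move=> phi /G_total[psi psiX Gpp]; exists psi; rewrite // Gpp fixK.
by move=> phi phi' psi phiY phiY' /andP[Gp pK] /andP[Gp' _];
  apply: (G_inj _ _ psi).
Qed.
End Center.

Lemma first_argmin (f : nat -> int) N : 0 < N -> exists2 k, k < N &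
  (forall j, j < N -> (f k <= f j)%R) /\ (forall j, j < k -> (f k < f j)%R).
Proof.
case: N => // N _; elim: N => [|N [k kN [le lt]]]; first by exists 0;
  split=> [[]|].
case: (ltP (f N.+1) (f k)) => c.
  exists N.+1 => //; split=> j jN; last by have := le j jN; lia.
  by have := le j; case: (altP (j =P N.+1)) => [->//|ne] /(_ ltac:(lia)); lia.
exists k; first lia.
split=> // j jN; have := le j; case: (altP (j =P N.+1)) => [->//|ne] /(_
  ltac:(lia)); lia.
Qed.

Lemma last_argmin (f : nat -> int) N : 0 < N -> exists2 k, k < N &
  (forall j, j < N -> (f k <= f j)%R) /\ (forall j, k < j < N -> (f k < f j)%R).
Proof.
case: N => // N _; elim: N => [|N [k kN [le lt]]].
  by exists 0 => //; split=> j; [case: j => [|[|]]|lia].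
case: (leP (f N.+1) (f k)) => c.
  exists N.+1 => //; split=> j jN; last lia.
  by have := le j; case: (altP (j =P N.+1)) => [->//|ne] /(_ ltac:(lia)); lia.
exists k; first lia.
split=> j jN; case: (altP (j =P N.+1)) => [->|ne] //.
- exact: ltW.
- by apply: le; lia.
- by apply: lt; lia.
Qed.

Lemma sum_porbits (T : finType) (r : {perm T}) (F : {set T} -> nat) :
  \sum_x F (porbit r x) = \sum_(O in porbits r) #|O| * F O.
Proof.
rewrite (partition_big_imset (porbit r)) /=;
  apply: eq_bigr => _ /imsetP[x _ ->].
rewrite (eq_bigr (fun _ => F (porbit r x))); last by move=> y /eqP ->.
rewrite sum_nat_const; congr (_ * _); apply: eq_card => y.
by rewrite -[LHS]/(porbit r y == porbit r x) eq_porbit_mem.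
Qed.

Lemma dvdn_porbit (T : finType) (r : {perm T}) x k :
  iter k r x = x -> #|porbit r x| %| k.
Proof.
move=> rk; set L := #|porbit r x|.
have L0 : 0 < L by rewrite card_gt0; apply/set0Pn; exists x; apply: porbit_id.
have rL j : iter (j * L) r x = x.
  by elim: j => // j IH; rewrite mulSn iterD IH iter_porbit.
have e : iter (k %% L) r x = x.
  by rewrite -{2}rk {2}(divn_eq k L) addnC iterD rL.
have kL : k %% L < L by rewrite ltn_mod.
have := uniq_traject_porbit r x; rewrite -/L => /(nth_uniq x) U.
have := U (k %% L) 0; rewrite size_traject kL L0 => /(_ isT isT).
by rewrite !nth_traject // e eqxx => /esym.
Qed.

(** * The two kinds of centers *)

Section Centers.
Variables (a m : nat).
Local Notation b := m.+2.
Local Notation n := m.+1.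
Hypotheses (a_gt0 : 0 < a) (co_ab : coprime a b).
Implicit Types (psi phi : {ffun 'I_a -> 'I_b}) (k s t : label b).
Local Notation parking := (parking a m).

(** Run 0 is a P-rise. Likewise [light_max] says that the last run is a Q-rise. *)
Definition heavy0 psi : bool := a < b * fiber psi 0.
Definition light_max psi : bool := b * fiber psi n < a.

Lemma plevel1 psi : plevel psi 1 = ((b * fiber psi 0)%:Z - a%:Z)%R.
Proof. by rewrite plevelS // plevel0 add0r. Qed.

Lemma pleveln psi : plevel psi n = (a%:Z - (b * fiber psi n)%:Z)%R.
Proof. by have := @plevelS _ _ psi n (ltnSn _); rewrite plevelb; lia. Qed.

Lemma prev_low1 psi : psi \in parking -> prev_low (plevel psi) 1 = 0.
Proof.
move=> /(parking_excursion a_gt0 co_ab) hE.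
by have [] := @prev_lowP _ _ hE 1 isT; rewrite ltnS leqn0 => /eqP.
Qed.

Lemma next_lown psi : psi \in parking -> next_low m (plevel psi) n = b.
Proof.
move=> /(parking_excursion a_gt0 co_ab) hE.
by have [] := @next_lowP _ _ hE n ltac:(lia); lia.
Qed.

Lemma block_first psi : psi \in parking ->
  path_block psi ord0 = inl [set k | prev_low (plevel psi) (lab k) == 0].
Proof.
move=> pK; rewrite /path_block /vertex_block /= plevel0.
by have /parkingP := pK => /(_ a_gt0 co_ab 1 isT) ->.
Qed.

Lemma block_last psi : psi \in parking ->
  path_block psi ord_max = inr [set k | next_low m (plevel psi) (lab k) == b].
Proof.
move=> pK; rewrite /path_block /vertex_block /= plevelb.
by have /parkingP := pK => /(_ a_gt0 co_ab n ltac:(lia));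
  rewrite ltNge le_eqVlt => /norP[_ /negbTE ->].
Qed.

Lemma card_centered_first (w : 'S_a) s : s != 0%R ->
  #|@centered_fixed a m true w s| = #|@equivariant a m ord0 heavy0 w s|.
Proof.
move=> s0; apply: (@card_centered_fixed _ _ a_gt0 co_ab ord0 0%R) => //.
- by move=> psi pK; rewrite block_first // inE /= prev_low1.
- move=> psi i pK; rewrite /path_block /vertex_block; case: ifP => //= _ _.
  by rewrite inE prev_low1 // => /eqP e; apply: ord_inj.
- move=> psi k pK; rewrite block_first // inE => /eqP k0.
  have hE := parking_excursion a_gt0 co_ab pK.
  have [_ hk hlt] := prev_lowP hE (lab_bound k); rewrite k0 in hk hlt.
  apply: cshift_first_parking => // j; rewrite sub0r opprK => jk.
    have := exc_gt0 hE (_ : 0 < j < b) => /(_ ltac:(lia)).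
    have : (plevel psi (lab k) <= plevel psi 1)%R; last lia.
    case: (posnP k) => [kk|kk]; first by rewrite /lab kk.
    by apply: ltW; apply: hlt; rewrite /lab ltnS.
  by apply: hlt; rewrite /lab ltnS.
- by move=> t psi i pK pK'; apply: path_block_cshift_first.
- move=> psi /(parking_excursion a_gt0 co_ab) hE; rewrite /heavy0.
  by have := @exc_gt0 _ _ hE 1 isT; rewrite plevel1; lia.
- move=> t psi; rewrite /heavy0; congr (_ < _ * _).
  by have := fiber_move psi ord0 (@cshift_inj _ ord0 t); rewrite cshift_center.
move=> psi; rewrite /heavy0 => h1.
(* Cut at the first minimum of the levels at 1, ..., n: strictness is needed only before it, since
   later levels are raised by [plevel psi 1 > 0]. *)
have [k kn [le lt]] := first_argmin (fun j => plevel psi j.+1) (ltn0Sn m).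
pose k' : label b := Ordinal kn; exists (- k')%R.
apply: cshift_first_parking => // j; rewrite opprK /= => jk.
  case: j jk => // j jk.
  by have := le j ltac:(lia); rewrite plevel1 /lab /=; lia.
move: jk; case: j => [|j] jk; first by [].
by apply: lt; move: jk; lia.
Qed.

Lemma card_centered_last (w : 'S_a) s : s != 0%R ->
  #|@centered_fixed a m false w s| = #|@equivariant a m ord_max light_max w s|.
Proof.
move=> s0; apply: (@card_centered_fixed _ _ a_gt0 co_ab ord_max ord_max) => //.
- by move=> psi pK; rewrite block_last // inE /= next_lown.
- move=> psi i pK; rewrite /path_block /vertex_block; case: ifP => //= _ _.
  by rewrite inE next_lown // => /eqP e; apply: ord_inj => /=; lia.
- move=> psi k pK; rewrite block_last // inE => /eqP kb.
  have hE := parking_excursion a_gt0 co_ab pK.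
  have kbd := lab_bound k.
  have [_ hk hlt] := next_lowP hE kbd; rewrite kb in hk hlt.
  (* The cut is [lab k] modulo n; for [lab k = n] it is 0 and nothing moves. *)
  have e : (- (ord_max - k)%R)%R = lab k %% n :> nat.
    by rewrite opprB /= modnDmr subSnn addn1.
  apply: cshift_last_parking => // j; rewrite e => jk.
    move: jk; case: (altP (lab k =P n)) => [->|ne].
      by rewrite modnn plevel0 => jk; apply: (exc_gt0 hE).
    by rewrite modn_small; [apply: hlt|lia].
  move: jk; case: (altP (lab k =P n)) => [->|ne]; first by rewrite modnn; lia.
  rewrite modn_small; last lia.
  move=> jk; have := exc_gt0 hE (_ : 0 < j < b) => /(_ ltac:(lia)).
  by have := hlt n ltac:(lia); lia.
- by move=> t psi i pK pK'; apply: path_block_cshift_last.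
- move=> psi /(parking_excursion a_gt0 co_ab) hE; rewrite /light_max.
  by have := @exc_gt0 _ _ hE n ltac:(lia); rewrite pleveln; lia.
- move=> t psi; rewrite /light_max; congr (_ * _ < _).
  by have := fiber_move psi ord_max (@cshift_inj _ ord_max t);
    rewrite cshift_center.
move=> psi; rewrite /light_max => h1.
(* Cut at the last minimum of the levels at 0, ..., n-1: strictness is needed only after it, since
   earlier levels are raised by [plevel psi n > 0]. *)
have [k kn [le lt]] := last_argmin (fun j => plevel psi j) (ltn0Sn m).
pose k' : label b := Ordinal kn; exists (- k')%R.
have le0 := le 0 isT; rewrite plevel0 in le0.
apply: cshift_last_parking => // j; rewrite opprK /= => jk.
  case: (altP (j =P n)) => [->|ne]; first by rewrite pleveln; lia.
  by apply: lt; lia.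
by have := le j ltac:(lia); rewrite pleveln; lia.
Qed.

Lemma fixed_block_exists (w : 'S_a) s psi : psi \in @park_fixed a m w s ->
  exists i, rot_block s (path_block psi i) = path_block psi i.
Proof.
case: (eqVneq s 0%R) => [->|s0].
  by move=> _; exists ord0; rewrite -[0%R in LHS]oppr0 rot_block0.
rewrite inE => /andP[pK /eqP psifix].
have hE := parking_excursion a_gt0 co_ab pK.
have bI := path_block_inj a_gt0 co_ab pK.
have step i : exists j, path_block psi j == rot_block s (path_block psi i).
  (* Relabelling by the inverse of w keeps the blocks, so rotation by s permutes the blocks of psi
     itself. *)
  have e : path_family (relabel w^-1 psi) = rot_family s (path_family psi).
    by rewrite path_family_relabel -{1}psifix perm_familyK.
  have pK' : relabel w^-1 psi \in parking by rewrite relabel_parking.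
  have [j jE] := path_block_support a_gt0 co_ab i pK pK' e.
  by exists j; rewrite -jE path_block_relabel.
pose rho0 i := xchoose (step i).
have rho0E i : path_block psi (rho0 i) = rot_block s (path_block psi i).
  by apply/eqP; apply: (xchooseP (step i)).
have rho0I : injective rho0.
  move=> i j /(congr1 (path_block psi)); rewrite !rho0E => /(can_inj
    (rot_blockK s)).
  exact: bI.
pose rho := perm rho0I.
have rhoE (k : nat) i : path_block psi (iter k rho i) = rot_block (s *+ k)%R
  (path_block psi i).
  elim: k => [|k IH]; first by rewrite mulr0n -[0%R in RHS]oppr0 rot_block0.
  by rewrite iterS permE rho0E IH mulrS rot_block_add.
case: (pickP (fun i => rho i == i)) => [i /eqP ri|none].
  by exists i; rewrite -rho0E -{2}ri permE.
(* Otherwise the rotation by s times the orbit length is nonzero and fixes the blocks of both i and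
   rho i, which must then be equal. *)
have sL i : (s *+ #|porbit rho i| = 0)%R.
  apply/eqP/negPn/negP => ne; suff : rho i == i by rewrite none.
  apply/eqP.
  apply: ord_inj; apply: (rot_fixed_unique hE ne) => //.
    by rewrite -/(path_block psi (rho i)) -rhoE -iterSr iterS iter_porbit.
  by rewrite -/(path_block psi i) -rhoE iter_porbit.
have dvd (k : nat) i : (s *+ k = 0)%R -> #|porbit rho i| %| k.
  move=> sk; apply: dvdn_porbit; apply: bI.
  by rewrite rhoE sk -[0%R in LHS]oppr0 rot_block0.
set q := #|porbit rho ord0|.
have qE i : #|porbit rho i| = q.
  by apply/eqP; rewrite eqn_dvd !dvd // /q sL.
have qn : q %| n.
  by apply: dvd; apply: val_inj; rewrite Zp_mulrn /= modnMl.
have qb : q %| b.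
  have := sum_porbits rho (fun=> 1); rewrite sum1_card card_ord => ->.
  by apply: dvdn_sum => _ /imsetP[i _ ->]; rewrite qE muln1.
have q1 : q = 1.
  by apply/eqP; rewrite -dvdn1 -(dvdn_addr _ qn) addn1.
have := porbit_id rho ord0; have := cards1P (_ : #|porbit rho ord0| == 1).
move/(_ (introT eqP q1)) => [x xE]; have := mem_porbit rho 1 ord0.
rewrite expg1 xE !inE => /eqP e1 /eqP e2.
by have := none ord0; rewrite e1 -e2 eqxx.
Qed.
End Centers.

(** * Counting fixed points, for nonzero and for zero rotation *)

Section Count.
Variables (a m : nat).
Local Notation b := m.+2.
Local Notation n := m.+1.
Hypotheses (a_gt0 : 0 < a) (co_ab : coprime a b).
Implicit Types (psi phi : {ffun 'I_a -> 'I_b}) (s t : label b).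
Local Notation parking := (parking a m).

(** Moves the last index to the front and keeps the order of the others, which conjugates the shifts
    around the two kinds of centers. *)
Definition last_to_first (i : 'I_b) : 'I_b :=
  if unlift ord_max i is Some j then lift ord0 j else ord0.

Lemma last_to_first_inj : injective last_to_first.
Proof.
move=> i j; rewrite /last_to_first.
case: (unliftP ord_max i) => [i' ->|->];
  case: (unliftP ord_max j) => [j' ->|->].
- by move=> /lift_inj ->.
- by move=> e; have := neq_lift ord0 i'; rewrite e eqxx.
- by move=> e; have := neq_lift ord0 j'; rewrite -e eqxx.
by [].
Qed.

Lemma last_to_first_cshift s i :
  last_to_first (cshift ord_max s i) = cshift ord0 s (last_to_first i).
Proof.
case: (unliftP ord_max i) => [j ->|->].
  by rewrite cshift_lift /last_to_first !liftK cshift_lift.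
by rewrite cshift_center /last_to_first unlift_none cshift_center.
Qed.

Lemma card_equivariant_last (w : 'S_a) s :
  #|equivariant ord_max (@light_max a m) w s| =
  #|[set phi | ~~ heavy0 phi &&
    (relabel w (move_index (cshift ord0 s) phi) == phi)]|.
Proof.
have [g gK Kg] := injF_bij last_to_first_inj.
have mvI : injective (@move_index a m last_to_first).
  move=> psi psi' /ffunP e; apply/ffunP => y; have := e y.
  by rewrite !ffunE => /last_to_first_inj.
rewrite -[LHS](card_imset _ mvI); apply: eq_card => phi; rewrite [in RHS]inE.
have fE psi : fiber (move_index last_to_first psi) 0 = fiber psi n.
  have := fiber_move psi ord_max last_to_first_inj.
  by rewrite /last_to_first unlift_none.
have heavyE psi : ~~ heavy0 (move_index last_to_first psi) = light_max psi.
  rewrite /heavy0 /light_max fE -leqNgt leq_eqVlt.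
  (* Equality would make b divide a, contradicting coprimality as b >= 2. *)
  suff /negbTE -> : b * fiber psi n != a by [].
  apply/eqP => e; have /gcdn_idPr g_b : b %| a
    by rewrite -[X in _ %| X]e dvdn_mulr.
  by move: co_ab; rewrite /coprime g_b.
have relE psi : (relabel w (move_index (cshift ord0 s) (move_index
  last_to_first psi))
      == move_index last_to_first psi)
    = (relabel w (move_index (cshift ord_max s) psi) == psi).
  rewrite -[RHS](inj_eq mvI); congr (_ == _).
  by apply/ffunP => y; rewrite !ffunE last_to_first_cshift.
apply/imsetP/andP => [[psi]|[hphi ephi]].
  by rewrite inE => /andP[lpsi epsi] ->; rewrite heavyE relE.
pose psi := move_index g phi.
have e : phi = move_index last_to_first psi.
  by apply/ffunP => y; rewrite !ffunE Kg.
by exists psi; rewrite // inE -heavyE -relE -e hphi.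
Qed.

(** A fixed psi has exactly one invariant block, in P or in Q. An equivariant phi has a heavy run 0
    or not. The two alternatives correspond, P to heavy. *)
Lemma card_park_fixed_rot (w : 'S_a) s : s != 0%R ->
  #|@park_fixed a m w s| =
  #|[set phi : {ffun 'I_a ->
    'I_b} | relabel w (move_index (cshift ord0 s) phi) == phi]|.
Proof.
move=> s0; set E := [set phi | _].
have -> : #|E| = #|@centered_fixed a m true w s| + #|@centered_fixed a m
  false w s|.
  rewrite card_centered_first // card_centered_last // card_equivariant_last.
  rewrite -(cardsID [set phi | heavy0 phi] E); congr (_ + _);
    by apply: eq_card => phi; rewrite !inE // andbC.
rewrite -(cardsID (@centered_fixed a m true w s)); congr (_ + _);
  apply: eq_card => psi.
  by rewrite [in LHS]inE andb_idl // inE => /andP[].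
rewrite [in LHS]inE; case: (boolP (psi \in park_fixed w s)) => pX; last first.
  by rewrite andbF inE (negbTE pX).
rewrite andbT [in RHS]inE inE pX /=.
have [i ifix] := fixed_block_exists a_gt0 co_ab pX.
have pK : psi \in parking by move: pX; rewrite inE => /andP[].
have uniq j : rot_block s (path_block psi j) = path_block psi j -> j = i.
  move=> jfix; apply: ord_inj.
  exact: (rot_fixed_unique (parking_excursion a_gt0 co_ab pK) s0).
have ex side : [exists j, (block_side (path_block psi j) == side)
    && (rot_block s (path_block psi j) == path_block psi j)]
    = (block_side (path_block psi i) == side).
  apply/existsP/idP => [[j /andP[js /eqP /uniq <-]] //|is_].
  by exists i; rewrite is_ ifix eqxx.
by rewrite !ex; case: block_side.
Qed.

Definition cyc (r i : 'I_b) : 'I_b := (i - r)%R.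

Lemma cyc_inj r : injective (cyc r).
Proof. exact: addIr. Qed.

Definition cyc_nat (r j : nat) : nat := if r <= j then j - r else j + b - r.

Lemma val_cyc (r i : 'I_b) : cyc r i = cyc_nat r i :> nat.
Proof.
rewrite /cyc /cyc_nat /=; have ib := ltn_ord i; have rb := ltn_ord r.
case: (posnP r) => [->|r0].
  by rewrite subn0 modnn addn0 modn_small // subn0.
rewrite (@modn_small (b - r)); last lia.
case: leqP => c; last by rewrite modn_small; lia.
by rewrite (_ : i + (b - r) = i - r + b) ?modnDr ?modn_small; lia.
Qed.

Section Cycle.
Variables (r : 'I_b) (psi : {ffun 'I_a -> 'I_b}).
Let phi := move_index (cyc r) psi.
Let steps := plevel_move psi (@cyc_inj r) (val_cyc r).

Let cyc_low k : k <= b - r ->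
  (plevel phi k = plevel psi (r + k) - plevel psi r)%R.
Proof.
elim: k => [_|k IH kb]; first by rewrite addn0 plevel0; lia.
have := steps (_ : r + k < b) => /(_ ltac:(lia)); rewrite /cyc_nat leq_addr.
have -> : r + k - r = k by lia.
by rewrite addnS -/phi; have := IH ltac:(lia); lia.
Qed.

Let cyc_high i : i <= r ->
  (plevel phi (b - r + i) = plevel psi i - plevel psi r)%R.
Proof.
have rb := ltn_ord r; elim: i => [_|i IH ir].
  by rewrite addn0 cyc_low // subnKC ?plevelb ?plevel0 //; lia.
have := steps (_ : i < b) => /(_ ltac:(lia)); rewrite /cyc_nat leqNgt ir /=.
have -> : i + b - r = b - r + i by lia.
by rewrite addnS -/phi; have := IH ltac:(lia); lia.
Qed.

(** The cycle lemma in levels: starting the path at r subtracts [plevel psi r] from all levels. *)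
Lemma cyc_parking : (forall j, j < b -> j != r ->
  (plevel psi r < plevel psi j)%R) <->
  phi \in parking.
Proof.
have rb := ltn_ord r; split=> [rmin|pK j jb jr].
  apply/parkingP => // k kb; case: (leqP k (b - r)) => kr.
    rewrite cyc_low //; case: (altP (r + k =P b)) => [e|ne].
      by have := rmin 0 isT; rewrite e plevelb plevel0 => /(_ ltac:(lia)); lia.
    by have := rmin (r + k) ltac:(lia) ltac:(lia); lia.
  have := @cyc_high (k - (b - r)) ltac:(lia); rewrite subnKC; last lia.
  by have := rmin (k - (b - r)) ltac:(lia) ltac:(lia); lia.
have {pK}pos : forall k, 0 < k < b -> (0 < plevel phi k)%R by apply/parkingP.
case: (ltngtP j r) jr => // c _; last first.
  have := @cyc_low (j - r) ltac:(lia); rewrite subnKC; last lia.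
  by have := pos (j - r) ltac:(lia); lia.
case: (posnP j) c => [->|j0] c.
  have := @cyc_high 0 isT; rewrite addn0.
  by have := pos (b - r) ltac:(lia); lia.
by have := @cyc_high j ltac:(lia); have := pos (b - r + j) ltac:(lia); lia.
Qed.
End Cycle.

Lemma move_cycK (r : 'I_b) psi :
  move_index (cyc r) (move_index (cyc (- r)%R) psi) = psi.
Proof. by apply/ffunP => y; rewrite !ffunE /cyc opprK addrK. Qed.

Lemma move_cycVK (r : 'I_b) psi :
  move_index (cyc (- r)%R) (move_index (cyc r) psi) = psi.
Proof. by apply/ffunP => y; rewrite !ffunE /cyc opprK subrK. Qed.

Lemma park_fixed0E (w : 'S_a) psi :
  (psi \in @park_fixed a m w 0%R) = (psi \in parking) && (relabel w psi == psi).
Proof.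
rewrite inE; case: (boolP (psi \in parking)) => //= pK.
rewrite rot_family0 -path_family_relabel; apply/eqP/eqP => [e|-> //].
by apply: (path_family_inj a_gt0 co_ab) => //; rewrite relabel_parking.
Qed.

(** Rotating a parking function by t is undone by starting at the lowest level, whose position is
    unique because coprimality separates the levels. *)
Lemma card_park_fixed0 (w : 'S_a) :
  #|@park_fixed a m w 0%R| * b =
  #|[set phi : {ffun 'I_a -> 'I_b} | relabel w phi == phi]|.
Proof.
pose f (x : {ffun 'I_a -> 'I_b} * 'I_b) := move_index (cyc (- x.2)%R) x.1.
have relf r psi : (relabel w (move_index (cyc r) psi) == move_index (cyc r) psi)
    = (relabel w psi == psi).
  rewrite relabel_move; apply/eqP/eqP => [|-> //].
  by move/(congr1 (move_index (cyc (- r)%R))); rewrite !move_cycVK.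
have -> : #|@park_fixed a m w 0%R| * b =
  #|setX (@park_fixed a m w 0%R) [set: 'I_b]|.
  by rewrite cardsX cardsT card_ord.
rewrite -(card_in_imset (f := f)).
  apply: eq_card => phi; rewrite [in RHS]inE; apply/imsetP/idP.
    by move=> [[psi t]]; rewrite in_setX park_fixed0E => /andP[/andP[_ e] _]
      ->; rewrite relf.
  move=> ephi; have [r rb [rmin _]] := first_argmin (plevel phi) (ltn0Sn n).
  pose r0 := Ordinal rb; exists (move_index (cyc r0) phi, r0);
    last by rewrite /f move_cycVK.
  rewrite in_setX in_setT andbT park_fixed0E relf ephi andbT.
  apply/cyc_parking => j jb jr; rewrite lt_neqAle rmin // andbT.
  apply: contra jr => /eqP /esym /(level_inj_mod a_gt0 co_ab).
  by rewrite !modn_small // => ->.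
move=> [psi t] [psi' t']; rewrite !in_setX !park_fixed0E /f /=.
move=> /andP[/andP[pK _] _] /andP[/andP[pK' _] _] e.
have psiE : psi = move_index (cyc t) (move_index (cyc (- t)%R) psi)
  by rewrite move_cycK.
have psiE' : psi' = move_index (cyc t') (move_index (cyc (- t)%R) psi) by
  rewrite e move_cycK.
have [_ tmin] := cyc_parking t (move_index (cyc (- t)%R) psi).
have [_ tmin'] := cyc_parking t' (move_index (cyc (- t)%R) psi).
have tt' : t = t'.
  apply/eqP/negPn/negP => ne; rewrite psiE in pK; rewrite psiE' in pK'.
  have := tmin pK t' (ltn_ord _); have := tmin' pK' t (ltn_ord _).
  by rewrite !(inj_eq val_inj) [t' == t]eq_sym ne => /(_ isT) h1 /(_ isT);
    rewrite ltNge (ltW h1).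
by rewrite psiE psiE' -tt'.
Qed.
End Count.

(** * Counting equivariant functions *)

Section Equivariant.
Variables (a m : nat).
Local Notation b := m.+2.
Local Notation n := m.+1.
Hypothesis a_gt0 : 0 < a.
Variables (w : 'S_a) (c : 'I_b) (s : label b).
Implicit Types (phi : {ffun 'I_a -> 'I_b}) (y : 'I_a) (O : {set 'I_a}).

Definition killed_cycles : {set {set 'I_a}} :=
  [set O in porbits w | (s *+ #|O| == 0)%R].

Let y0 : 'I_a := Ordinal a_gt0.
(** Each cycle gets a base point [rep], and [pos y] counts the steps of w from it to y. *)
Let rep O := odflt y0 [pick y in O].
Let pos y := let O := porbit w y in index y (traject w (rep O) #|O|).

Let porbit_rep y : porbit w (rep (porbit w y)) = porbit w y.
Proof.
apply/eqP; rewrite eq_porbit_mem /rep; case: pickP => //= /(_ y).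
by rewrite porbit_id.
Qed.

Let iter_pos y : iter (pos y) w (rep (porbit w y)) = y.
Proof.
rewrite /pos; set O := porbit w y; have yO : y \in traject w (rep O) #|O|.
  by rewrite /O -{2}porbit_rep -porbit_traject porbit_rep porbit_id.
have lt : index y (traject w (rep O) #|O|) < #|O|.
  by rewrite -[X in _ < X](size_traject w (rep O)) index_mem.
by rewrite -(nth_traject w lt) nth_index.
Qed.

Let pos_rep y : pos (rep (porbit w y)) = 0.
Proof.
rewrite /pos porbit_rep; have : 0 < #|porbit w y|.
  by rewrite card_gt0; apply/set0Pn; exists y; apply: porbit_id.
by case: #|_| => //= k _; rewrite eqxx.
Qed.

Lemma cshift_mulrn k i : iter k (cshift c s) i = cshift c (s *+ k)%R i.
Proof.
elim: k => [|k IH]; first by rewrite mulr0n cshift0.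
by rewrite iterS IH -cshiftD mulrS.
Qed.

Lemma equivariantP phi :
  reflect (forall y, phi (w y) = cshift c s (phi y)) (relabel w (move_index
    (cshift c s) phi) == phi).
Proof.
apply: (iffP eqP) => [/ffunP e y|e].
  by rewrite -e !ffunE permK.
by apply/ffunP => y; rewrite !ffunE -{2}[y](permKV w) e.
Qed.

Let equiv_iter phi k y : (forall y, phi (w y) = cshift c s (phi y)) ->
  phi (iter k w y) = cshift c (s *+ k)%R (phi y).
Proof.
by move=> e; rewrite -cshift_mulrn; elim: k => //= k IH; rewrite e IH.
Qed.

Let cshift_fixed k i : (s *+ k != 0)%R -> cshift c (s *+ k)%R i = i -> i = c.
Proof.
case: (unliftP c i) => [j ->|-> //] k0; rewrite cshift_lift => /lift_inj /eqP.
by rewrite -subr_eq0 addrAC subrr add0r (negbTE k0).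
Qed.

(** Two walks to the same point differ by a multiple of the cycle length, which kills s, so the
    value along such a cycle is well defined. *)
Let iter_eq_mulrn j k y : (s *+ #|porbit w y| = 0)%R ->
  iter j w y = iter k w y -> (s *+ j = s *+ k)%R.
Proof.
move=> sL; wlog jk : j k / j <= k.
  by move=> H e; case: (leqP j k) => [/H|/ltnW /H]; [apply|move=> ->].
move=> e; have : iter (k - j) w y = y.
  have : injective (iter j w)
    by elim: j {jk e} => // j IH x x' /= /perm_inj /IH.
  by apply; rewrite -iterD subnKC // e.
move=> /dvdn_porbit /dvdnP[q qE].
by rewrite -[in RHS](subnKC jk) mulrnDr qE mulnC mulrnA sL mul0rn addr0.
Qed.

(** The value at the base point is free on a killed cycle. On any other cycle, going around once is
    a nonzero shift fixing the value, which must be c. *)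
Lemma card_equivariant :
  #|[set phi : {ffun 'I_a ->
    'I_b} | relabel w (move_index (cshift c s) phi) == phi]|
  = b ^ #|killed_cycles|.
Proof.
(* g holds the values at the base points, equal to c off the killed cycles; f propagates them along
   w. *)
pose f (g : {ffun {set 'I_a} -> 'I_b}) : {ffun 'I_a -> 'I_b} :=
  [ffun y => cshift c (s *+ pos y)%R (g (porbit w y))].
have -> : b ^ #|killed_cycles| =
  #|pffun_on c (mem killed_cycles) (@predT 'I_b)|.
  by rewrite card_pffun_on card_ord.
rewrite -(card_in_imset (f := f)); last first.
  move=> g g' /pffun_onP[gs _] /pffun_onP[gs' _] /ffunP e; apply/ffunP => O.
  case: (boolP (O \in killed_cycles)) => [|nO].
    rewrite inE => /andP[/imsetP[y _ ->] _].
    by have := e (rep (porbit w y));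
      rewrite !ffunE pos_rep porbit_rep mulr0n !cshift0.
  have out (h : {ffun {set 'I_a} ->
    'I_b}) : c.-support h \subset killed_cycles -> h O = c.
    by move=> /subsetP /(_ O); rewrite unfold_in => hs;
      apply/eqP/negPn/negP => /hs; rewrite (negbTE nO).
  by rewrite !out.
apply: eq_card => phi; rewrite [in LHS]inE;
  apply/equivariantP/imsetP => [e|[g gs ->] y].
  pose g : {ffun {set 'I_a} -> 'I_b} :=
    [ffun O => if O \in killed_cycles then phi (rep O) else c].
  exists g.
    apply/pffun_onP; split=> //; apply/subsetP => O; rewrite unfold_in ffunE.
    by case: ifP => //; rewrite eqxx.
  apply/ffunP => y; rewrite !ffunE; case: ifP => [_|].
    by rewrite -equiv_iter // iter_pos.
  rewrite inE imset_f //= => /negbT nL; rewrite cshift_center;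
    apply: (cshift_fixed nL).
  by rewrite -equiv_iter // iter_porbit.
rewrite !ffunE; have pw : porbit w (w y) = porbit w y.
  by apply/eqP; rewrite eq_sym eq_porbit_mem porbit_sym;
    have := mem_porbit w 1 y; rewrite expg1.
rewrite pw -cshiftD -mulrS.
case: (boolP (porbit w y \in killed_cycles)) => [|nO].
  rewrite inE => /andP[_ /eqP sL]; congr cshift.
  (* At the end of a cycle [pos] returns to 0 instead of increasing; multiplied by s the two counts
     agree. *)
  apply: (@iter_eq_mulrn _ _ (rep (porbit w y))); first by rewrite porbit_rep.
  by rewrite iterS iter_pos -{1}pw iter_pos.
have -> : g (porbit w y) = c; last by rewrite !cshift_center.
case/pffun_onP: gs => /subsetP /(_ (porbit w y)); rewrite unfold_in => hs _.
by apply/eqP/negPn/negP => /hs; rewrite (negbTE nO).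
Qed.
End Equivariant.

(** * Eigenvalue multiplicities *)

Section Multiplicity.
Local Open Scope ring_scope.

Lemma sum_expr_unity (F : fieldType) N (z : F) : z ^+ N = 1 ->
  \sum_(k < N) z ^+ k = (N * (z == 1%R))%:R.
Proof.
move=> zN; case: eqP => [->|/eqP z1].
  rewrite muln1 (eq_bigr (fun=> 1)) ?sumr_const ?card_ord // => k _.
  exact: expr1n.
rewrite muln0; apply: (mulfI (x := z - 1)); first by rewrite subr_eq0.
by rewrite -subrX1 zN subrr mulr0.
Qed.

Lemma char_poly_conj (F : fieldType) d (P A : 'M[F]_d) : P \in unitmx ->
  char_poly (invmx P *m A *m P) = char_poly A.
Proof.
move=> Pu; rewrite /char_poly.
have -> : char_poly_mx (invmx P *m A *m P) =
    map_mx polyC (invmx P) *m char_poly_mx A *m map_mx polyC P.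
  rewrite /char_poly_mx mulmxBr mulmxBl !map_mxM; congr (_ - _).
  by rewrite scalar_mxC -mulmxA -map_mxM mulVmx // map_mx1 mulmx1.
by rewrite !det_mulmx mulrAC -det_mulmx -map_mxM mulVmx // map_mx1 det1 mul1r.
Qed.

Lemma mup_char_poly_diag (F : fieldType) d (D : 'rV[F]_d) z :
  mup z (char_poly (diag_mx D)) = (\sum_(i < d) (D 0%R i == z))%N.
Proof.
rewrite char_poly_trig ?diag_mx_is_trig //.
have -> : \prod_(i < d) ('X - (diag_mx D i i)%:P) =
    \prod_(y <- [seq D 0 i | i <- enum 'I_d]) ('X - y%:P).
  by rewrite big_map big_enum; apply: eq_bigr => i _; rewrite mxE eqxx.
rewrite mu_prod_XsubC -sum1_count big_map big_enum_cond big_mkcond /=.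
by apply: eq_bigr => i _; case: eqP.
Qed.

(** The minimal polynomial divides X^N - 1, which splits with simple roots in characteristic 0. *)
Lemma unity_diagonalizable (F : numClosedFieldType) d N (A : 'M[F]_d.+1) :
  (0 < N)%N -> A ^+ N = 1 -> diagonalizable A.
Proof.
move=> N0 AN; apply/diagonalizableP.
have [rs rsE] := closed_field_poly_normal ('X^N - 1 : {poly F}).
have lc : lead_coef ('X^N - 1 : {poly F}) = 1.
  by apply/monicP; apply: monicXnsubC.
rewrite lc scale1r in rsE; exists rs.
  by rewrite -separable_prod_XsubC -rsE separable_Xn_sub_1 // pnatr_eq0 -lt0n.
rewrite -rsE; apply: mxminpoly_min.
by rewrite rmorphB rmorph1 /= rmorphXn /= horner_mx_X AN subrr.
Qed.

(** Fourier inversion: the eigenvalues x are N-th roots of unity, and the sum of (x / z)^k over k <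
    N is N if x = z and 0 otherwise. *)
Lemma mup_char_poly_unity (F : numClosedFieldType) d N (A : 'M[F]_d.+1) (z :
  F) :
  (0 < N)%N -> A ^+ N = 1 -> z ^+ N = 1 ->
  (N * mup z (char_poly A))%:R = \sum_(k < N) z ^- k * \tr (A ^+ k).
Proof.
move=> N0 AN zN.
have [P Pu /(diagonalizable_forLR Pu) [D AE]] := unity_diagonalizable N0 AN.
rewrite mxpoly.conjVmx // in AE.
have z0 : z != 0 by apply: contra_eq_neq zN => ->; rewrite expr0n;
  case: N N0 {AN} => //= N _; rewrite eq_sym oner_eq0.
have AX k : A ^+ k = invmx P *m diag_mx (map_mx (fun x => x ^+ k) D) *m P.
  elim: k => [|k IH].
    rewrite expr0 (_ : map_mx _ D = const_mx 1).
      by rewrite diag_const_mx mulmx1 mulVmx.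
    by apply/matrixP => i j; rewrite !mxE expr0.
  rewrite exprSr IH [X in _ * X]AE -mulmxE !mulmxA; congr (_ *m P).
  rewrite -!mulmxA; congr (_ *m _); rewrite !mulmxA mulmxK // mulmx_diag;
    congr diag_mx.
  by apply/rowP => j; rewrite !mxE exprSr.
have DN i : D 0 i ^+ N = 1.
  have : diag_mx (map_mx (fun x => x ^+ N) D) = 1.
    have e := AX N; rewrite AN in e; set B := diag_mx _ in e *.
    have -> : B = P *m 1%:M *m invmx P.
      by rewrite -[1%:M]/(1 : 'M_d.+1) e !mulmxA mulmxV // mul1mx -mulmxA
        mulmxV // mulmx1.
    by rewrite mulmx1 mulmxV.
  by move/matrixP/(_ i i); rewrite !mxE eqxx.
have trX k : \tr (A ^+ k) = \sum_i D 0 i ^+ k.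
  rewrite AX mxtrace_mulC mulmxA mulmxV // mul1mx mxtrace_diag.
  by apply: eq_bigr => i _; rewrite mxE.
rewrite AE char_poly_conj // mup_char_poly_diag.
under [RHS]eq_bigr => k _ do rewrite -AE trX mulr_sumr.
rewrite exchange_big /= big_distrr /= natr_sum; apply: eq_bigr => i _.
rewrite (eq_bigr (fun k : 'I_N => (D 0 i / z) ^+ k)); last first.
  by move=> k _; rewrite expr_div_n mulrC.
rewrite sum_expr_unity ?expr_div_n ?DN ?zN ?divr1 //.
by rewrite (can2_eq (divfK z0) (mulfK z0)) mul1r.
Qed.

(** * Multiplicities in the reflection representation, read from cycles *)

Section Reflection.
Variables (F : numClosedFieldType) (a : nat).
Hypothesis a_gt0 : (0 < a)%N.
Implicit Types (w v : 'S_a).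

Lemma rank_ones : \rank (const_mx 1 : 'M[F]_a) = 1%N.
Proof.
apply/eqP; rewrite eqn_leq; apply/andP; split.
  have -> : (const_mx 1 : 'M[F]_a) =
    (const_mx 1 : 'cV_a) *m (const_mx 1 : 'rV_a).
    by apply/matrixP => i j; rewrite !mxE big_ord1 !mxE mulr1.
  by apply: leq_trans (mxrankM_maxl _ _) (rank_leq_col _).
rewrite lt0n mxrank_eq0;
  apply/eqP => /matrixP /(_ (Ordinal a_gt0) (Ordinal a_gt0)).
by rewrite !mxE => /eqP; rewrite oner_eq0.
Qed.

(** The line of (1, ..., 1) carries the trivial character, and the trace of a permutation matrix
    counts fixed points. *)
Lemma trace_refl v : \tr (refl_repr F a v) = #|[set y | v y == y]|%:R - 1.
Proof.
have := mxtrace_sub_fact_mod (ones_mxmodule F a) v.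
have -> : submod_repr (ones_mxmodule F a) v = 1%:M.
  rewrite /= /submod_mx; set V := val_submod _.
  have VV : V *m perm_mx v = V.
    have /submxP[M ->] : (V <= (const_mx 1 : 'M[F]_a))%MS by apply: val_submodP.
    rewrite -mulmxA; congr (_ *m _); rewrite -[v]invgK -col_permE.
    by apply/matrixP => i j; rewrite !mxE.
  by rewrite VV val_submodK.
rewrite mxtrace1 rank_ones => e.
have -> : #|[set y | v y == y]|%:R = \tr (perm_mx v : 'M[F]_a).
  rewrite /mxtrace -sum1_card natr_sum big_mkcond /=; apply: eq_bigr => y _.
  by rewrite inE !mxE; case: eqP.
by move: e => /= <-; rewrite addrC addKr.
Qed.

(** Only the multiples k of the cycle length L fix y, which leaves a geometric sum of N / L terms in
    z^-L. *)
Lemma sum_fixed_orbit w N (z : F) y : (0 < N)%N -> z ^+ N = 1 ->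
  (w ^+ N = 1)%g ->
  \sum_(k < N) z ^- k * ((w ^+ k)%g y == y)%:R =
  ((N %/ #|porbit w y|) * (z ^+ #|porbit w y| == 1%R))%:R.
Proof.
move=> N0 zN wN; set L := #|porbit w y|.
have L0 : (0 < L)%N by rewrite card_gt0; apply/set0Pn; exists y;
  apply: porbit_id.
have fixE k : ((w ^+ k)%g y == y) = (L %| k)%N.
  apply/eqP/idP => [|/dvdnP[q ->]]; first by rewrite permX; apply: dvdn_porbit.
  rewrite permX; elim: q => // q IH.
  by rewrite mulSn addnC iterD iter_porbit IH.
have /dvdnP[M NE] : (L %| N)%N by rewrite -fixE wN perm1.
rewrite -(big_mkord xpredT (fun k => z ^- k * ((w ^+ k)%g y == y)%:R)).
have -> : \sum_(0 <= k < N) z ^- k * ((w ^+ k)%g y == y)%:R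
    = \sum_(j < M) (z ^- L) ^+ j.
  rewrite NE; elim: M {NE} => [|M IH];
    first by rewrite mul0n big_geq // big_ord0.
  rewrite mulSn addnC (big_cat_nat (n := M * L)%N) ?leq_addr //= IH
    big_ord_recr /=.
  congr (_ + _); rewrite big_ltn;
    last by rewrite -[X in (X < _)%N]addn0 ltn_add2l.
  rewrite big_nat_cond big1 ?addr0; last first.
    move=> k; rewrite andbT => kML;
      suff /negbTE -> : (w ^+ k)%g y != y by rewrite mulr0.
    rewrite fixE; apply/negP => /dvdnP[q qE]; move: kML; rewrite qE.
    by rewrite -mulSnr !ltn_pmul2r // ltnS => /andP[Mq]; rewrite leqNgt Mq.
  by rewrite fixE dvdn_mull // mulr1 mulnC exprM -exprVn.
have zL : (z ^- L) ^+ M = 1 by rewrite exprVn -exprM mulnC -NE zN invr1.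
by rewrite sum_expr_unity // NE mulnK // invr_eq1.
Qed.

(** Summed over its L points, a cycle of length L with z^L = 1 contributes L (N / L) = N. The
    trivial character removed from the trace accounts for the correction at z = 1. *)
Lemma eig_multE w N (z : F) : (0 < N)%N -> z ^+ N = 1 -> (w ^+ N = 1)%g ->
  (eig_mult w z + (z == 1%R) = #|[set O in porbits w | z ^+ #|O| == 1%R]|)%N.
Proof.
move=> N0 zN wN.
have key : (N * eig_mult w z)%:R =
    \sum_(k < N) z ^- k * \tr (refl_repr F a (w ^+ k)%g) :> F.
  rewrite /eig_mult; move: (refl_repr F a).
  (* Square matrices form a ring only in positive size, so V = 0, the case a = 1, is treated
     apart. *)
  case: (\rank _) => [|d] rG.
    rewrite big1 => [|k _]; last by rewrite /mxtrace big_ord0 mulr0.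
    rewrite (_ : mup z _ = 0%N) ?muln0 //; apply: mupNroot.
    by rewrite /char_poly det_mx00 root1.
  have rX k : rG (w ^+ k)%g = rG w ^+ k by rewrite repr_mxX ?inE.
  under eq_bigr => k _ do rewrite rX.
  by apply: mup_char_poly_unity; rewrite // -rX wN repr_mx1.
have sumE : \sum_(k < N) z ^- k * \tr (refl_repr F a (w ^+ k)%g) =
    (N * #|[set O in porbits w | z ^+ #|O| == 1%R]|)%:R - (N * (z == 1%R))%:R.
  under eq_bigr => k _ do rewrite trace_refl mulrBr mulr1.
  rewrite sumrB; congr (_ - _); last first.
    under eq_bigr => k _ do rewrite -exprVn.
    by rewrite sum_expr_unity ?invr_eq1 // exprVn zN invr1.
  rewrite (eq_bigr (fun k : 'I_N => \sum_y z ^- k * ((w ^+ k)%g y == y)%:R)).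
    rewrite exchange_big /=; under eq_bigr => y _ do rewrite sum_fixed_orbit //.
    rewrite -natr_sum (sum_porbits w (fun O =>
      (N %/ #|O| * (z ^+ #|O| == 1%R))%N)).
    congr (_%:R); rewrite -sum1_card big_distrr /= big_mkcond [RHS]big_mkcond
      /=.
    apply: eq_bigr => O _; rewrite inE; case: (boolP (O \in porbits w)) => //=
      /imsetP[y _ ->].
    rewrite mulnA [(#|_| * _)%N]mulnC divnK; last by apply: dvdn_porbit;
      rewrite -permX wN perm1.
    by case: eqP => _; rewrite ?muln1 ?muln0.
  move=> k _; rewrite -mulr_sumr -sum1_card natr_sum big_mkcond /=;
    congr (_ * _).
  by apply: eq_bigr => y _; rewrite inE; case: eqP.
move: key; rewrite sumE => /eqP; rewrite eq_sym subr_eq -natrD -mulnDr eqr_nat.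
by rewrite eqn_pmul2l // => /eqP.
Qed.
End Reflection.
End Multiplicity.

(** * The order of the root of unity zeta *)

Section Zeta.
Local Open Scope ring_scope.
Variables (R : realType) (n : nat).
Hypothesis n_gt0 : (0 < n)%N.

Lemma zetaX k : zeta R n ^+ k =
  (cos (2 * pi / n%:R * k%:R) +i* sin (2 * pi / n%:R * k%:R))%C.
Proof.
elim: k => [|k IH]; first by rewrite expr0 mulr0 cos0 sin0.
rewrite exprSr IH /zeta; set t := 2 * pi / n%:R.
have -> : t * k.+1%:R = t * k%:R + t by rewrite -natr1 mulrDr mulr1.
by rewrite cosD sinD [X in _ = (_ +i* X)%C]addrC.
Qed.

Lemma zeta_expr_eq1 k : (zeta R n ^+ k == 1) = (n %| k)%N.
Proof.
have nR : (n%:R : R) != 0 by rewrite pnatr_eq0 -lt0n.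
have zn : zeta R n ^+ n = 1.
  by rewrite zetaX divfK // mulr_natl cos2pi sin2pi.
rewrite (divn_eq k n) exprD [(_ * n)%N]mulnC exprM zn expr1n mul1r.
rewrite dvdn_addr ?dvdn_mulr //.
have rn : (k %% n < n)%N by rewrite ltn_mod.
case: (posnP (k %% n)) => [->|r0]; first by rewrite expr0 eqxx dvdn0.
rewrite gtnNdvd //; apply/negbTE/eqP; rewrite zetaX => -[c1 _].
pose x : R := pi / n%:R * (k %% n)%:R.
have nR0 : (0 : R) < n%:R by rewrite ltr0n.
have xpi : 0 < x < pi.
  rewrite mulr_gt0 ?divr_gt0 ?pi_gt0 ?ltr0n //=.
  by rewrite /x mulrAC ltr_pdivrMr // ltr_pM2l ?pi_gt0 // ltr_nat.
have xE : 2 * pi / n%:R * (k %% n)%:R = x *+ 2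
  by rewrite -[RHS]mulr_natl /x !mulrA.
rewrite xE cos_mulr2n in c1.
(* [cos (2 x) = 1] would give [sin x = 0], impossible for 0 < x < pi. *)
by have := sin_gt0_pi xpi; have := cos2Dsin2 x; nra.
Qed.
End Zeta.

(** * The character formula *)

Theorem theorem7p2 (R : realType) (a b : nat) (ha : 0 < a) (hb : 2 <= b)
    (hab : coprime a b) (w : 'S_a) (d : nat) :
  perm_char R[i] (park_action a b) (ParkNC a b) (w, (rot_gen b ^+ d)%g)
  = (b%:R ^+ eig_mult w (zeta R b.-1 ^+ d))%R.
Proof.
case: b hb hab => [|[|m]] // _ hab; rewrite perm_char_park //.
set s : label m.+2 := (rot_gen m.+2 ^+ d)%g.
(* Both sides say that b - 1 divides d L. *)
have sL L : (s *+ L == 0)%R = ((zeta R m.+1 ^+ d) ^+ L == 1)%R.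
  rewrite -exprM zeta_expr_eq1 // -val_eqE.
  rewrite /s -[(_ ^+ d)%g]/(rot_gen m.+2 *+ d)%R -mulrnA Zp_mulrn /= modnMml
    mul1n.
  by [].
have killedE : killed_cycles w s =
  [set O in porbits w | ((zeta R m.+1 ^+ d) ^+ #|O| == 1)%R].
  by apply/setP => O; rewrite !inE sL.
have mE : (eig_mult w (zeta R m.+1 ^+ d) + (s == 0%R) = #|killed_cycles w s|)%N.
  (* The exponent [#[w] * m.+1] kills both w and the root of unity. *)
  rewrite killedE -(@eig_multE R[i] a ha w (#[w]%g * m.+1)).
  - by congr (_ + nat_of_bool _); rewrite -[s]mulr1n sL expr1.
  - by rewrite muln_gt0 order_gt0.
  - by apply/eqP; rewrite -exprM zeta_expr_eq1 // !dvdn_mull.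
  by rewrite expgM expg_order expg1n.
rewrite -natrX; congr (_%:R)%R; case: (eqVneq s 0%R) mE => [s0|s0].
  rewrite addn1 => mE; apply/eqP;
    rewrite -(eqn_pmul2r (ltn0Sn m.+1)) -expnSr mE s0.
  (* For s = 0 the factor b of the cycle lemma matches the multiplicity lost to the trivial
     character. With shift 0 all cycles are killed and equivariance is invariance under w. *)
  rewrite card_park_fixed0 // -(card_equivariant ha w ord0 0%R).
  by apply/eqP/eq_card => phi; rewrite !inE shift0.
by rewrite addn0 => ->; rewrite card_park_fixed_rot // card_equivariant.
Qed.
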